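(* Let $(K(\theta):\theta\in(a,b))$, $(\tilde f(\theta):\theta\in(a,b))$ and $u^*(\theta)=\sum_{n=0}^\infty K^n(\theta)\tilde f(\theta)$ be as in the context. Suppose there exist a measurable $w:C\to[1,\infty)$ and $\theta_0\in(a,b)$ for which: (a) $|||K^m(\theta_0)|||_w<1$ for some $m\ge 1$; (b) $K(\cdot)$ is (continuously) differentiable in $\mathcal L_w$ at $\theta_0$, with derivative $K'(\theta_0)$; (c) $\tilde f(\cdot)$ is (continuously) differentiable in $L_w$ at $\theta_0$, with derivative $\tilde f'(\theta_0)$. Then: (i) $I-K(\theta)$ is invertible on $L_w$ for $\theta$ in a neighborhood of $\theta_0$; (ii) setting $G(\theta)=(I-K(\theta))^{-1}$, $G(\cdot)$ is (continuously) differentiable in $\mathcal L_w$ at $\theta_0$, and $G'(\theta_0)=G(\theta_0)K'(\theta_0)G(\theta_0)$; (iii) $u^*(\theta)=\sum_{n=0}^\infty K^n(\theta)\tilde f(\theta)$ is (continuously) differentiable in $L_w$ at $\theta_0$, with $$(u^* )'(\theta_0)=G'(\theta_0)\tilde f(\theta_0)+G(\theta_0)\tilde f'(\theta_0).$$ If, in addition, $K(\cdot)$ and $\tilde f(\cdot)$ are $n$-times (continuously) differentiable in $\mathcal L_w$ and $L_w$, respectively, at $\theta_0$, then $G(\cdot)$ and $u^*(\cdot)$ are $n$-times (continuously) differentiable at $\theta_0$ in $\mathcal L_w$ and $L_w$, respectively, and $$G^{(n)}(\theta_0)=\sum_{j=0}^{n-1}\binom nj G^{(j)}(\theta_0)K^{(n-j)}(\theta_0)G(\theta_0),$$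 $$(u^* )^{(n)}(\theta_0)=G(\theta_0)\Big(\tilde f^{(n)}(\theta_0)+\sum_{j=0}^{n-1}\binom nj K^{(n-j)}(\theta_0)(u^* )^{(j)}(\theta_0)\Big).$$ Here the word ''(continuously)'' is to be read consistently: the theorem asserts both the version with all occurrences omitted and the version with all occurrences included.
   Context: $S$ is a measurable space, $C\subseteq S$ is measurable (possibly $C=S$), $f:S\to[0,\infty)$ and $g:S\to\mathbb R$ are measurable, and for each $\theta\in(a,b)$, $P(\theta)=(P(\theta,x,dy))$ is a Markov transition kernel on $S$. $K(\theta)$ is the non-negative kernel on $C$ given by $K(\theta,x,dy)=e^{g(x)}P(\theta,x,dy)$, $x,y\in C$, and $\tilde f(\theta,x)=f(x)+\int_{C^c}e^{g(x)}P(\theta,x,dy)f(y)$ for $x\in C$. The function $u^*(\theta)=\sum_{n\ge0}K^n(\theta)\tilde f(\theta)$ equals $\mathbf E^\theta_x\big[\sum_{j=0}^{T-1}e^{\sum_{k=0}^{j-1}g(X_k)}f(X_j)+e^{\sum_{k=0}^{T-1}g(X_k)}f(X_T)\big]$, where $X$ is the Markov chain with transition kernel $P(\theta)$, $X_0=x\in C$, and $T=\inf\{n\ge0:X_n\in C^c\}$ (the last term being absent on $\{T=\infty\}$). Kernels act on functions and compose in the usual way: $(Qh)(x)=\int h(y)Q(x,dy)$, $(Q_1Q_2)(x,A)=\int Q_1(x,dy)Q_2(y,A)$, $Q^0(x,dy)=\delta_x(dy)$, $Q^n=QQ^{n-1}$. $I$ is the identity kernel. For measurable $w:C\to[1,\infty)$: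 $\|h\|_w=\sup_{x\in C}|h(x)|/w(x)$; $L_w$ is the space of measurable $h:C\to\mathbb R$ with $\|h\|_w<\infty$; for a (signed) kernel $Q$ on $C$, $|||Q|||_w=\sup\{\|Qh\|_w/\|h\|_w:h\in L_w,\|h\|_w\ne0\}$; $\mathcal L_w$ is the space of (signed) kernels on $C$ with $|||Q|||_w<\infty$. In the hypotheses, $K(\theta)\in\mathcal L_w$ and $\tilde f(\theta)\in L_w$ for $\theta\in(a,b)$. A family $(Q(\theta))$ in $\mathcal L_w$ is differentiable in $\mathcal L_w$ at $\theta_0$ with derivative $Q'(\theta_0)\in\mathcal L_w$ if $|||h^{-1}(Q(\theta_0+h)-Q(\theta_0))-Q'(\theta_0)|||_w\to0$ as $h\to0$; it is continuously differentiable at $\theta_0$ if it is differentiable in a neighborhood of $\theta_0$ and $Q'(\cdot)$ is continuous at $\theta_0$ in $\mathcal L_w$. If $Q(\cdot)$ is $n$-times differentiable in a neighborhood of $\theta_0$ with $n$th derivative $Q^{(n)}(\cdot)$, it is $(n+1)$-times (continuously) differentiable at $\theta_0$ if $Q^{(n)}(\cdot)$ is (continuously) differentiable at $\theta_0$, and $Q^{(n+1)}$ is the derivative of $Q^{(n)}$; $Q^{(0)}=Q$. The same definitions apply to families in $L_w$ with $\|\cdot\|_w$. *)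

(* Defs.v *)
From HB Require Import structures.
From mathcomp Require Import all_boot all_order all_algebra.
From mathcomp Require Import all_classical all_reals all_analysis.

Set Implicit Arguments.
Unset Strict Implicit.
Unset Printing Implicit Defensive.

Import Order.TTheory GRing.Theory Num.Theory.
Import numFieldNormedType.Exports.

Local Open Scope classical_set_scope.
Local Open Scope ring_scope.

(* Functions and kernels on C are represented by functions S -> R and set
   functions S -> set S -> R, of which only the values at points x of C and at
   measurable A `<=` C are meaningful.  This keeps them in the canonical
   lmodTypes of functions (and allows C to be empty, whereas a subtype of S
   would have to be pointed to be a measurableType). *)

Section WeightedSpaces.
Context {d : measure_display} {S : measurableType d} {R : realType}.
Implicit Types (C : set S) (w h : S -> R) (nu : set S -> R)
  (Q : S -> set S -> R).

(* Upper variation of a signed measure nu on C; the lower one is the upper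
   variation of -nu, and nu is their difference (Jordan decomposition). *)
Definition upper_variation C nu (A : set S) : \bar R :=
  ereal_sup [set (nu B)%:E | B in [set B | measurable B /\ B `<=` A `&` C]].

(* Infinite (+oo or -oo) as soon as one of the four integrals of h^+ and h^-
   against the two variations is infinite. *)
Definition signed_integral C nu (h : S -> R) : \bar R :=
  (\int[upper_variation C nu]_(y in C) (h y)%:E
   - \int[upper_variation C (- nu)%R]_(y in C) (h y)%:E)%E.

Definition eskact C Q h (x : S) : \bar R := signed_integral C (Q x) h.

Definition skact C Q h (x : S) : R := fine (eskact C Q h x).

Definition skcomp C Q1 Q2 : S -> set S -> R :=
  fun x A => skact C Q1 (fun y => Q2 y A) x.

Definition skid : S -> set S -> R := fun x A => \1_A x.

Fixpoint skpow C Q (n : nat) : S -> set S -> R :=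
  if n is n'.+1 then skcomp C Q (skpow C Q n') else skid.

Definition signed_kernel C Q : Prop :=
  (forall x, C x -> exists m : {charge set S -> \bar R},
     forall A, measurable A -> A `<=` C -> (Q x A)%:E = m A) /\
  (forall A, measurable A -> A `<=` C -> measurable_fun C (Q ^~ A)).

(* Suprema of norms are taken in [0, +oo], so that the empty one (which occurs
   when C is empty) is 0. *)
Definition sup0 (X : set (\bar R)) : \bar R := maxe 0%E (ereal_sup X).

Definition ewnorm C w (h : S -> \bar R) : \bar R :=
  sup0 [set (`|h x| / (w x)%:E)%E | x in C].

Definition wnorm C w h : \bar R := ewnorm C w (EFin \o h).

Definition Lw C w : set (S -> R) :=
  [set h | measurable_fun C h /\ (wnorm C w h < +oo)%E].

(* Using eskact rather than skact makes the norm infinite unless every h in L_w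
   is Q x-integrable for all x in C. *)
Definition sknorm C w Q : \bar R :=
  sup0 [set (ewnorm C w (eskact C Q h) / wnorm C w h)%E
       | h in [set h | Lw C w h /\ wnorm C w h != 0%E]].

Definition LLw C w : set (S -> set S -> R) :=
  [set Q | signed_kernel C Q /\ (sknorm C w Q < +oo)%E].

Definition invertible_on_Lw C w (A : (S -> R) -> (S -> R)) : Prop :=
  (forall u, Lw C w u -> Lw C w (A u)) /\
  exists M : R, forall h, Lw C w h ->
    exists u, [/\ Lw C w u,
      {in C, A u =1 h},
      (forall v, Lw C w v -> {in C, A v =1 h} -> {in C, v =1 u}) &
      (wnorm C w u <= M%:E * wnorm C w h)%E].

Definition inverse_on_Lw C w Q G : Prop :=
  forall h, Lw C w h ->
    {in C, skact C G (skact C Q h) =1 h} /\ {in C, skact C Q (skact C G h) =1 h}.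

End WeightedSpaces.

(* Differentiability of a family F in a subspace M of V normed by N; it is
   used with (M, N) = (Lw C w, wnorm C w) and (LLw C w, sknorm C w). *)
Section Differentiability.
Context {R : realType} {V : lmodType R}.
Variables (M : set V) (N : V -> \bar R).
Implicit Types (F : R -> V) (t : R) (D : V).

Definition has_deriv F t D : Prop :=
  [/\ (\forall s \near t, M (F s)), M D &
      (fun h : R => N (h^-1 *: (F (t + h) - F t) - D)) @ 0^' --> 0%E].

Definition has_cont_deriv F t D : Prop :=
  exists F' : R -> V,
    [/\ (\forall s \near t, has_deriv F s (F' s)), F' t = D &
        (fun s => N (F' s - D)) @ t --> 0%E].

(* The flag cont selects the reading of "(continuously)". *)
Definition has_cderiv (cont : bool) F t D : Prop :=
  if cont then has_cont_deriv F t D else has_deriv F t D.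

(* F is n times (continuously) differentiable at t, with DF j s the j-th
   derivative at s, for j < n and s near t, and for j = n and s = t. *)
Fixpoint has_ncderiv (cont : bool) (n : nat) F t (DF : nat -> R -> V) : Prop :=
  if n is n'.+1 then
    (\forall s \near t, has_ncderiv false n' F s DF) /\
    has_cderiv cont (DF n') t (DF n'.+1 t)
  else DF 0%N = F.

End Differentiability.

Section Model.
Context {d : measure_display} {S : measurableType d} {R : realType}.
Variables (C : set S) (f g : S -> R) (P : R -> R.-pker S ~> S).

Definition Kfam (t : R) : S -> set S -> R :=
  fun x A => expR (g x) * fine (P t x A).

Definition eftilde (t : R) (x : S) : \bar R :=
  ((f x)%:E + \int[P t x]_(y in ~` C) (expR (g x) * f y)%:E)%E.

Definition ftilde (t : R) (x : S) : R := fine (eftilde t x).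

Definition eustar (t : R) (x : S) : \bar R :=
  (\sum_(0 <= n <oo) eskact C (skpow C (Kfam t) n) (ftilde t) x)%E.

Definition ustar (t : R) (x : S) : R := fine (eustar t x).

End Model.

(* Main.v *)
Require Import Defs.
From HB Require Import structures.
From mathcomp Require Import all_boot all_order all_algebra.
From mathcomp Require Import all_classical all_reals all_analysis.
From mathcomp Require Import measurable_realfun.
From mathcomp Require Import ring lra.

Set Implicit Arguments.
Unset Strict Implicit.
Unset Printing Implicit Defensive.

Import Order.TTheory GRing.Theory Num.Theory.
Import numFieldNormedType.Exports.

Local Open Scope classical_set_scope.
Local Open Scope ring_scope.

(** The resolvent G = (I - K)^-1 and u* = G f~ both solve an equation
    u = phi + K u: for u* the operator K acts on functions and phi = f~, for G
    it acts on kernels by composition on the right and phi is the identity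
    kernel.  Such a solution inherits the smoothness of K and phi.  Indeed
    [diff_solution], the remainder u(s) - u(t) - (s - t) v, where v solves the
    formally differentiated equation v = phi' + K' u + K v, is itself mapped by
    I - K(s) to a quantity of order o(s - t), and the a priori bound
    |z| <= B |z - K(s) z|, uniform for s near t, turns this into the same order
    for the remainder.  The derivative v solves an equation of the same kind,
    so the argument iterates; the right hand sides that appear are given by the
    Leibniz formula, and Pascal's rule matches them ([cdiff_leibniz]).  For
    j-th derivatives u_j this gives u_n = G (phi_n + sum_(j < n) C(n, j)
    K_(n-j) u_j), which is the announced formula in both cases.

    The a priori bound comes from the Neumann series.  The m-th power of K(s)
    depends continuously on s, hence stays a strict contraction near t0, and
    the powers of K(s) decay like D r^n with D and r independent of s
    ([geometric_decay]).  So G(s) is the sum of the K(s)^n ([neumann]), with a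
    norm bounded by D / (1 - r), and the series that defines u* converges to
    G(s) f~(s).

    All this takes place among operators, whereas the spaces at hand consist of
    kernels.  The two are the same: integration against a kernel of finite norm
    is an operator on L_w that is bounded and continuous along dominated
    pointwise convergence, and every such operator T is integration against the
    kernel that sends (x, B) to the value at x of T applied to the indicator of
    B ([op_of_kernel], [kernel_of_op], [isolift_LLw]).  Starting from T, the
    measures T 1_B (x) are split by the Hahn decomposition, and the two halves
    are compared with T by a Daniell argument ([daniell]); starting from a
    kernel, finiteness of the norm makes w integrable for both variations
    ([LLw_jordan]).  Limits such as the Neumann series are thus taken among
    operators, where continuity along dominated convergence passes to norm
    limits, and only then read as kernels. *)

(** * Differentiation in seminormed spaces *)

Section Seminorm.
Context {R : realType}.

Record seminorm (V : lmodType R) (n : V -> R) : Prop := Seminorm {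
  seminormD : forall x y, n (x + y) <= n x + n y;
  seminormZ : forall c x, n (c *: x) = `|c| * n x }.

Variables (V : lmodType R) (n : V -> R) (sn : seminorm n).

Lemma seminorm0 : n 0 = 0.
Proof. by rewrite -(scale0r 0) (seminormZ sn) normr0 mul0r. Qed.

Lemma seminormN x : n (- x) = n x.
Proof. by rewrite -scaleN1r (seminormZ sn) normrN1 mul1r. Qed.

Lemma seminormB x y : n (x - y) <= n x + n y.
Proof. by rewrite -(seminormN y); exact: seminormD sn _ _. Qed.

Lemma seminorm_ge0 x : 0 <= n x.
Proof.
have := seminormB x x; rewrite subrr seminorm0 -mulr2n.
by rewrite pmulrn_lge0.
Qed.

Lemma seminorm_leB x y : n x <= n y + n (x - y).
Proof. by rewrite -{1}(subrK y x) addrC; exact: seminormD sn _ _. Qed.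

End Seminorm.

Section Calculus.
Context {R : realType}.

(** The o(s - t) form of differentiability: it has no division, so that s = t
    needs no special treatment. *)
Definition diff_at (V : lmodType R) (n : V -> R) (F : R -> V) t D : Prop :=
  forall e, 0 < e ->
    \forall s \near t, n (F s - F t - (s - t) *: D) <= e * `|s - t|.

Definition cts_at (V : lmodType R) (n : V -> R) (F : R -> V) t : Prop :=
  forall e, 0 < e -> \forall s \near t, n (F s - F t) <= e.

Definition cdiff_at (cont : bool) (V : lmodType R) (n : V -> R)
    (F : R -> V) t D : Prop :=
  diff_at n F t D /\
  (cont -> exists F' : R -> V,
    [/\ \forall s \near t, diff_at n F s (F' s), F' t = D & cts_at n F' t]).

Lemma near_small (t e : R) : 0 < e -> \forall s \near t, `|s - t| <= e.
Proof.
by move=> e0; apply/nbhs_ballP; exists e => //= s; rewrite /ball /= distrC => /ltW.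
Qed.

Section One.
Variables (V : lmodType R) (n : V -> R) (sn : seminorm n).
Implicit Types (F G : R -> V) (t : R).

Lemma diff_cts F t D : diff_at n F t D -> cts_at n F t.
Proof.
move=> dF e e0; have n0 := seminorm_ge0 sn D.
have k0 : 0 < 1 + n D by rewrite ltr_pwDl.
near=> s.
have h1 : n (F s - F t - (s - t) *: D) <= 1 * `|s - t| by near: s; exact: dF.
have h2 : `|s - t| <= e / (1 + n D) by near: s; apply: near_small; exact: divr_gt0.
rewrite -(subrK ((s - t) *: D) (F s - F t)).
apply: (le_trans (seminormD sn _ _)); rewrite (seminormZ sn).
apply: (@le_trans _ _ (`|s - t| * (1 + n D))).
  by rewrite mulrDr mulr1 lerD2r -[leRHS]mul1r.
by rewrite -ler_pdivlMr.
Unshelve. all: by end_near. Qed.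

Lemma cdiff_cts cont F t D : cdiff_at cont n F t D -> cts_at n F t.
Proof. by case=> /diff_cts. Qed.

Lemma eq_diff_at F G t D : (\forall s \near t, F s = G s) ->
  diff_at n F t D -> diff_at n G t D.
Proof.
move=> FG dF e e0; have FGt := nbhs_singleton FG.
near=> s; rewrite -FGt; have <- : F s = G s by near: s.
by near: s; exact: dF.
Unshelve. all: by end_near. Qed.

Lemma eq_cdiff_at cont F G t D : (\forall s \near t, F s = G s) ->
  cdiff_at cont n F t D -> cdiff_at cont n G t D.
Proof.
move=> FG [dF cF]; split; first exact: eq_diff_at dF.
move=> /cF[F' [dF' F't cF']]; exists F'; split => //.
near=> s; apply: (@eq_diff_at F); last by near: s.
near: s; exact: (near_join FG).
Unshelve. all: by end_near. Qed.

Lemma diff_cst x t : diff_at n (fun=> x) t 0.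
Proof.
move=> e e0; near=> s.
by rewrite subrr scaler0 subrr (seminorm0 sn) mulr_ge0// ltW.
Unshelve. all: by end_near. Qed.

Lemma cts_cst x t : cts_at n (fun=> x) t.
Proof. by move=> e e0; near=> s; rewrite subrr (seminorm0 sn) ltW.
Unshelve. all: by end_near. Qed.

Lemma cdiff_cst cont x t : cdiff_at cont n (fun=> x) t 0.
Proof.
split; first exact: diff_cst.
move=> _; exists (fun=> 0); split => //; last exact: cts_cst.
by near=> s; exact: diff_cst.
Unshelve. all: by end_near. Qed.

Lemma ctsD F G t : cts_at n F t -> cts_at n G t ->
  cts_at n (fun s => F s + G s) t.
Proof.
move=> cF cG e e0; near=> s; rewrite opprD addrACA.
apply: (le_trans (seminormD sn _ _)); rewrite (splitr e) lerD//.
  by near: s; apply: cF; exact: divr_gt0.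
by near: s; apply: cG; exact: divr_gt0.
Unshelve. all: by end_near. Qed.

Lemma ctsZ (c : R) F t : cts_at n F t -> cts_at n (fun s => c *: F s) t.
Proof.
move=> cF e e0; have k0 : 0 < `|c| + 1 by rewrite ltr_pwDr.
near=> s; rewrite -scalerBr (seminormZ sn).
apply: (@le_trans _ _ ((`|c| + 1) * (e / (`|c| + 1)))).
  apply: ler_pM => //; [exact: seminorm_ge0 sn _|by rewrite lerDl|].
  by near: s; apply: cF; exact: divr_gt0.
by rewrite mulrC divfK// gt_eqF.
Unshelve. all: by end_near. Qed.

Lemma diffD F G t D E : diff_at n F t D -> diff_at n G t E ->
  diff_at n (fun s => F s + G s) t (D + E).
Proof.
move=> cF cG e e0; near=> s.
rewrite scalerDr !opprD (addrACA (F s)) (addrACA (F s - F t)).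
apply: (le_trans (seminormD sn _ _)); rewrite (splitr e) mulrDl lerD//.
  by near: s; apply: cF; exact: divr_gt0.
by near: s; apply: cG; exact: divr_gt0.
Unshelve. all: by end_near. Qed.

Lemma diffZ (c : R) F t D : diff_at n F t D ->
  diff_at n (fun s => c *: F s) t (c *: D).
Proof.
move=> cF e e0; have k0 : 0 < `|c| + 1 by rewrite ltr_pwDr.
near=> s; rewrite scalerA [_ * c]mulrC -scalerA -!scalerBr (seminormZ sn).
apply: (@le_trans _ _ ((`|c| + 1) * (e / (`|c| + 1) * `|s - t|))).
  apply: ler_pM => //; [exact: seminorm_ge0 sn _|by rewrite lerDl|].
  by near: s; apply: cF; exact: divr_gt0.
by rewrite mulrA [_ * (e / _)]mulrC divfK// gt_eqF.
Unshelve. all: by end_near. Qed.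

Lemma cdiffD cont F G t D E : cdiff_at cont n F t D -> cdiff_at cont n G t E ->
  cdiff_at cont n (fun s => F s + G s) t (D + E).
Proof.
move=> [dF cF] [dG cG]; split; first exact: diffD.
move=> /[dup] /cF[F' [dF' F't cF']] /cG[G' [dG' G't cG']].
exists (fun s => F' s + G' s); split; [|by rewrite F't G't|exact: ctsD].
by near=> s; apply: diffD; near: s.
Unshelve. all: by end_near. Qed.

Lemma cdiffZ cont (c : R) F t D : cdiff_at cont n F t D ->
  cdiff_at cont n (fun s => c *: F s) t (c *: D).
Proof.
move=> [dF cF]; split; first exact: diffZ.
move=> /cF[F' [dF' F't cF']].
exists (fun s => c *: F' s); split; [|by rewrite F't|exact: ctsZ].
by near=> s; apply: diffZ; near: s.
Unshelve. all: by end_near. Qed.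

Lemma cdiff_sum cont k (F : 'I_k -> R -> V) t (D : 'I_k -> V) :
  (forall i, cdiff_at cont n (F i) t (D i)) ->
  cdiff_at cont n (fun s => \sum_i F i s) t (\sum_i D i).
Proof.
elim: k F D => [|k ih] F D dF.
  rewrite big_ord0; apply: eq_cdiff_at (cdiff_cst cont 0 t).
  by near=> s; rewrite big_ord0.
rewrite big_ord_recl.
apply: (@eq_cdiff_at _ (fun s => F ord0 s + \sum_(i < k) F (lift ord0 i) s)).
  by near=> s; rewrite big_ord_recl.
by apply: cdiffD => //; apply: ih.
Unshelve. all: by end_near. Qed.

End One.

Section Action.
Variables (U V : lmodType R) (nU : U -> R) (nV : V -> R).
Hypotheses (snU : seminorm nU) (snV : seminorm nV).
Variable act : U -> V -> V.
Hypotheses (actBl : forall p q y, act (p - q) y = act p y - act q y)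
  (actZl : forall c q y, act (c *: q) y = c *: act q y)
  (actBr : forall q y z, act q (y - z) = act q y - act q z)
  (actZr : forall c q y, act q (c *: y) = c *: act q y)
  (act_le : forall q y, nV (act q y) <= nU q * nV y).
Implicit Types (Q : R -> U) (y : R -> V) (t : R).

Let nU0 := seminorm_ge0 snU.
Let nV0 := seminorm_ge0 snV.

Lemma cts_act Q y t : cts_at nU Q t -> cts_at nV y t ->
  cts_at nV (fun s => act (Q s) (y s)) t.
Proof.
move=> cQ cy e e0.
pose k := nU (Q t) + nV (y t) + 1.
have k0 : 0 < k by rewrite /k ltr_wpDl// addr_ge0.
near=> s.
have h1 : nU (Q s - Q t) <= e / 2 / k by near: s; apply: cQ; rewrite !divr_gt0.
have h2 : nV (y s - y t) <= e / 2 / k by near: s; apply: cy; rewrite !divr_gt0.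
have h3 : nV (y s) <= nV (y t) + 1.
  rewrite -[y s](subrK (y t)) (le_trans (seminormD snV _ _))// addrC lerD2l.
  by near: s; apply: cy.
have -> : act (Q s) (y s) - act (Q t) (y t) =
    act (Q s - Q t) (y s) + act (Q t) (y s - y t).
  by rewrite actBl actBr addrA subrK.
apply: (le_trans (seminormD snV _ _)).
apply: (le_trans (lerD (act_le _ _) (act_le _ _))).
rewrite (splitr e).
have ek : e / 2 = e / 2 / k * k by rewrite divfK// gt_eqF.
rewrite {1}ek [X in _ <= _ + X]ek; apply: lerD; last rewrite mulrC.
  by apply: ler_pM => //; move: (nU0 (Q t)); rewrite /k; lra.
by apply: ler_pM => //; move: (nV0 (y t)); rewrite /k; lra.
Unshelve. all: by end_near. Qed.

(** Product rule: the remainder is the sum of the remainder of Q applied to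
    y s, of the remainder of y hit by Q t, and of a cross term that is small by
    continuity of y. *)
Lemma diff_act Q y t (Q' : U) (y' : V) : diff_at nU Q t Q' -> diff_at nV y t y' ->
  diff_at nV (fun s => act (Q s) (y s)) t (act Q' (y t) + act (Q t) y').
Proof.
move=> dQ dy e e0.
pose k := nU (Q t) + nV (y t) + nU Q' + 1.
have k0 : 0 < k by rewrite /k ltr_wpDl// !addr_ge0.
have ek0 : 0 < e / 3 / k by rewrite !divr_gt0.
near=> s.
have h1 : nU (Q s - Q t - (s - t) *: Q') <= e / 3 / k * `|s - t|.
  by near: s; exact: dQ.
have h2 : nV (y s - y t - (s - t) *: y') <= e / 3 / k * `|s - t|.
  by near: s; exact: dy.
have h3 : nV (y s - y t) <= e / 3 / k.
  by near: s; exact: (diff_cts snV dy).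
have h4 : nV (y s) <= nV (y t) + 1.
  rewrite -[y s](subrK (y t)) (le_trans (seminormD snV _ _))// addrC lerD2l.
  by near: s; exact: (diff_cts snV dy).
have -> : act (Q s) (y s) - act (Q t) (y t) -
      (s - t) *: (act Q' (y t) + act (Q t) y') =
    act (Q s - Q t - (s - t) *: Q') (y s) + (s - t) *: act Q' (y s - y t)
    + act (Q t) (y s - y t - (s - t) *: y').
  rewrite !actBl !actBr actZl actZr scalerBr scalerDr !opprD !addrA.
  by rewrite [RHS](ACl (1*7*5*8*6*2*4*3))/= !addrK.
apply: (le_trans (seminormD snV _ _)).
apply: (le_trans (lerD (seminormD snV _ _) (act_le _ _))).
rewrite (seminormZ snV).
have ee : e * `|s - t| = e / 3 / k * `|s - t| * k + `|s - t| * (k * (e / 3 / k))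
    + k * (e / 3 / k * `|s - t|).
  by field; rewrite gt_eqF.
rewrite ee; apply: lerD; first apply: lerD.
- apply: (le_trans (act_le _ _)); apply: ler_pM => //.
  by move: (nU0 (Q t)) (nU0 Q'); rewrite /k; lra.
- apply: ler_wpM2l => //; apply: (le_trans (act_le _ _)).
  by apply: ler_pM => //; move: (nU0 (Q t)) (nV0 (y t)); rewrite /k; lra.
- by apply: ler_pM => //; move: (nU0 Q') (nV0 (y t)); rewrite /k; lra.
Unshelve. all: by end_near. Qed.

Lemma cdiff_act cont Q y t (Q' : U) (y' : V) :
  cdiff_at cont nU Q t Q' -> cdiff_at cont nV y t y' ->
  cdiff_at cont nV (fun s => act (Q s) (y s)) t
    (act Q' (y t) + act (Q t) y').
Proof.
move=> [dQ cQ] [dy cy]; split; first exact: diff_act.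
move=> /[dup] /cQ[Q1 [dQ1 Q1t cQ1]] /cy[y1 [dy1 y1t cy1]].
exists (fun s => act (Q1 s) (y s) + act (Q s) (y1 s)); split.
- by near=> s; apply: diff_act; near: s.
- by rewrite Q1t y1t.
- apply: ctsD => //; apply: cts_act => //.
    exact: diff_cts dy.
  exact: diff_cts dQ.
Unshelve. all: by end_near. Qed.

(** * Solutions of u = phi + K u *)

Section Resolvent.
Variables (K : R -> U) (B : R).

Definition solves (u phi : R -> V) (s : R) : Prop :=
  u s = phi s + act (K s) (u s).

Let B0 t : (\forall s \near t, forall z, nV z <= B * nV (z - act (K s) z)) ->
  exists2 B', 0 < B' & \forall s \near t,
    forall z, nV z <= B' * nV (z - act (K s) z).
Proof.
move=> h; exists (`|B| + 1); first by rewrite ltr_wpDl.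
near=> s => z; 
have /(_ z) hz : forall z, nV z <= B * nV (z - act (K s) z) by near: s.
rewrite (le_trans hz)// ler_wpM2r//.
by rewrite (le_trans (ler_norm _))// lerDl.
Unshelve. all: by end_near. Qed.

(** u s - u t solves the equation at s with the small right hand side
    (phi s - phi t) + (K s - K t) u t. *)
Lemma cts_solution u phi t :
  (\forall s \near t, forall z, nV z <= B * nV (z - act (K s) z)) ->
  (\forall s \near t, solves u phi s) ->
  cts_at nU K t -> cts_at nV phi t -> cts_at nV u t.
Proof.
move=> /B0[B' B'0 bd] su cK cphi e e0.
have sut := nbhs_singleton su.
pose k := nV (u t) + 1; have k0 : 0 < k by rewrite /k ltr_wpDl.
near=> s.
have bds : forall z, nV z <= B' * nV (z - act (K s) z) by near: s.
apply: (le_trans (bds _)).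
have us : solves u phi s by near: s.
have -> : u s - u t - act (K s) (u s - u t) =
    (phi s - phi t) + act (K s - K t) (u t).
  have -> : phi s = u s - act (K s) (u s) by rewrite {1}us addrK.
  have -> : phi t = u t - act (K t) (u t) by rewrite {1}sut addrK.
  rewrite actBr actBl !opprD !opprK !addrA.
  by rewrite [RHS](ACl (1*3*2*5*4*6))/= addrK.
have h1 : nV (phi s - phi t) <= e / 2 / B'.
  by near: s; apply: cphi; rewrite !divr_gt0.
have h2 : nU (K s - K t) <= e / 2 / B' / k.
  by near: s; apply: cK; rewrite !divr_gt0.
apply: (@le_trans _ _ (B' * (e / 2 / B' + e / 2 / B' / k * k))); last first.
  by rewrite le_eqVlt; apply/orP; left; apply/eqP; field; rewrite !gt_eqF.
rewrite ler_pM2l//; apply: (le_trans (seminormD snV _ _)); apply: lerD => //.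
apply: (le_trans (act_le _ _)); apply: ler_pM => //.
by rewrite /k lerDl.
Unshelve. all: by end_near. Qed.

(** The remainder z of u at t is controlled by z - K s z, which only involves
    the remainders of phi and K and the term (s - t) (K s - K t) v. *)
Lemma diff_solution u phi t K' phi' v :
  (\forall s \near t, forall z, nV z <= B * nV (z - act (K s) z)) ->
  (\forall s \near t, solves u phi s) ->
  diff_at nU K t K' -> diff_at nV phi t phi' ->
  v = phi' + act K' (u t) + act (K t) v -> diff_at nV u t v.
Proof.
move=> /B0[B' B'0 bd] su dK dphi ve e e0.
have sut := nbhs_singleton su.
pose k := nV (u t) + nV v + 1.
have k0 : 0 < k by rewrite /k ltr_wpDl// addr_ge0.
have ek0 : 0 < e / 3 / B' / k by rewrite !divr_gt0.
near=> s.
pose z := u s - u t - (s - t) *: v.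
have bds : forall z, nV z <= B' * nV (z - act (K s) z) by near: s.
apply: (le_trans (bds _)).
have us : solves u phi s by near: s.
have -> : z - act (K s) z =
    (phi s - phi t - (s - t) *: phi') +
    act (K s - K t - (s - t) *: K') (u t) + (s - t) *: act (K s - K t) v.
  have -> : phi s = u s - act (K s) (u s) by rewrite {1}us addrK.
  have -> : phi t = u t - act (K t) (u t) by rewrite {1}sut addrK.
  have -> : phi' = v - act K' (u t) - act (K t) v.
    by rewrite {1}ve addrAC !addrK.
  rewrite /z !actBr !actBl actZl actZr !scalerBr !opprD !opprK !addrA.
  by rewrite [RHS](ACl (1*3*5*2*8*11*4*9*6*10*7*12))/= !addrK.
have h1 : nV (phi s - phi t - (s - t) *: phi') <= e / 3 / B' * `|s - t|.
  by near: s; apply: dphi; rewrite !divr_gt0.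
have h2 : nU (K s - K t - (s - t) *: K') <= e / 3 / B' / k * `|s - t|.
  by near: s; exact: dK.
have h3 : nU (K s - K t) <= e / 3 / B' / k.
  by near: s; exact: (diff_cts snU dK).
have -> : e * `|s - t| = B' * (e / 3 / B' * `|s - t|
    + e / 3 / B' / k * `|s - t| * k + `|s - t| * (e / 3 / B' / k * k)).
  by field; rewrite !gt_eqF.
rewrite ler_pM2l//; apply: (le_trans (seminormD snV _ _)).
apply: (le_trans (lerD (seminormD snV _ _) (lexx _))).
rewrite (seminormZ snV); apply: lerD; first apply: lerD => //.
- apply: (le_trans (act_le _ _)); apply: ler_pM => //.
  by move: (nV0 v); rewrite /k; lra.
- apply: ler_wpM2l => //; apply: (le_trans (act_le _ _)).
  by apply: ler_pM => //; move: (nV0 (u t)); rewrite /k; lra.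
Unshelve. all: by end_near. Qed.

Variable Gop : R -> V -> V.

Definition resolved s : Prop := (forall z, nV z <= B * nV (z - act (K s) z)) /\
  (forall z, Gop s z = z + act (K s) (Gop s z)).

Lemma cdiff_solution cont u phi t K' phi' v :
  (\forall s \near t, resolved s) ->
  (\forall s \near t, solves u phi s) ->
  cdiff_at cont nU K t K' -> cdiff_at cont nV phi t phi' ->
  v = phi' + act K' (u t) + act (K t) v -> cdiff_at cont nV u t v.
Proof.
move=> rs su [dK cK] [dphi cphi] ve.
have apr : \forall s \near t, forall z, nV z <= B * nV (z - act (K s) z).
  by apply: filterS rs => s [].
split; first exact: (diff_solution _ su dK dphi).
move=> /[dup] /cK[K1 [dK1 K1t cK1]] /cphi[p1 [dp1 p1t cp1]].
(* The seminorm need not separate points, so the value at t is imposed. *)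
pose v1 s := if s == t then v else Gop s (p1 s + act (K1 s) (u s)).
have v1s : \forall s \near t, solves v1 (fun s => p1 s + act (K1 s) (u s)) s.
  near=> s; rewrite /solves /v1; case: eqVneq => [->|_].
    by rewrite K1t p1t.
  have [_] : resolved s by near: s.
  exact.
exists v1; split; [|by rewrite /v1 eqxx|].
- near=> s; apply: (@diff_solution _ phi _ (K1 s) (p1 s)).
  + by near: s; exact: (near_join apr).
  + by near: s; exact: (near_join su).
  + by near: s.
  + by near: s.
  + suff : solves v1 (fun s => p1 s + act (K1 s) (u s)) s by [].
    by near: s.
- apply: (cts_solution apr v1s); first exact: diff_cts dK.
  apply: ctsD => //; apply: cts_act => //.
  apply: (cts_solution apr su); first exact: diff_cts dK.
  exact: diff_cts dphi.
Unshelve. all: by end_near. Qed.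

(** Differentiating u = f + K u formally n times gives
    u_n = leibniz_rhs n + K u_n: the term j = n of the Leibniz formula is kept
    apart, since it contains the unknown u_n itself. *)
Definition leibniz_rhs (DK : nat -> R -> U) (Df Du : nat -> R -> V) n s : V :=
  Df n s + \sum_(j < n) 'C(n, j)%:R *: act (DK (n - j)%N s) (Du j s).

Lemma pascal_sum n (x : nat -> V) :
  \sum_(j < n.+1) 'C(n.+1, j)%:R *: x j =
  \sum_(j < n) 'C(n, j)%:R *: (x j + x j.+1) + x n :> V.
Proof.
rewrite big_ord_recl bin0 scale1r.
under [X in _ + X]eq_bigr do rewrite lift0 binS natrD scalerDl.
rewrite big_split/= addrA.
have -> : x 0%N + \sum_(j < n) 'C(n, j.+1)%:R *: x j.+1 =
    \sum_(j < n.+1) 'C(n, j)%:R *: x j.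
  by rewrite big_ord_recl bin0 scale1r.
rewrite big_ord_recr/= binn scale1r addrAC -big_split/=.
by congr (_ + _); apply: eq_bigr => j _; rewrite -scalerDr.
Qed.

(** Induction on the order: the right hand side of order n is differentiable by
    the product rule, hence so is the solution Du n, and the derivative solves
    the equation of order n.+1 because the term K' (Du n) completes the sum into
    the one given by Pascal's rule. *)
Lemma cdiff_leibniz cont N t DK Df Du :
  (\forall s \near t, resolved s) -> DK 0%N = K ->
  (\forall s \near t, forall n, solves (Du n) (leibniz_rhs DK Df Du n) s) ->
  (forall n, (n <= N)%N -> cdiff_at cont nU (DK n) t (DK n.+1 t)) ->
  (forall n, (n <= N)%N -> cdiff_at cont nV (Df n) t (Df n.+1 t)) ->
  forall n, (n <= N)%N -> cdiff_at cont nV (Du n) t (Du n.+1 t).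
Proof.
move=> rs DK0 sDu dK df n; elim/ltn_ind: n => n ih nN.
have dpsi : cdiff_at cont nV (leibniz_rhs DK Df Du n) t
    (Df n.+1 t + \sum_(j < n) 'C(n, j)%:R *:
       (act (DK (n - j).+1 t) (Du j t) + act (DK (n - j)%N t) (Du j.+1 t))).
  apply: cdiffD => //; first exact: df.
  apply: (@cdiff_sum _ nV snV cont n
    (fun j s => 'C(n, j)%:R *: act (DK (n - j)%N s) (Du j s))) => j.
  apply: cdiffZ => //; apply: cdiff_act.
    by apply: dK; rewrite (leq_trans (leq_subr _ _)).
  by apply: ih => //; rewrite (leq_trans _ nN)// ltnW.
apply: cdiff_solution rs _ _ dpsi _.
- by near=> s; have : forall n, solves (Du n) (leibniz_rhs DK Df Du n) s; [near: s|exact].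
- by rewrite -DK0; apply: dK.
- have {1}-> : Du n.+1 t = leibniz_rhs DK Df Du n.+1 t + act (K t) (Du n.+1 t).
    exact: (nbhs_singleton sDu).
  congr (_ + _); rewrite /leibniz_rhs.
  rewrite (pascal_sum n (fun j => act (DK (n.+1 - j)%N t) (Du j t))) addrA.
  rewrite subSnn; congr (_ + _ + _); apply: eq_bigr => j _.
  by rewrite subSS subSn// ltnW.
Unshelve. all: by end_near. Qed.

End Resolvent.
End Action.
End Calculus.
(** * Transfer between normed subspaces of kernels or functions and operators *)

Section Transfer.
Context {R : realType}.

(** phi identifies the elements of M that differ by a null element; on M it is
    linear and turns the extended norm N into the seminorm n, and kappa chooses
    representatives. Differentiability in (M, N) then amounts to
    differentiability of the image under phi. *)
Record isolift (V0 V : lmodType R) (M : set V0) (N : V0 -> \bar R)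
    (n : V -> R) (phi : V0 -> V) (kappa : V -> V0) : Prop := Isolift {
  liftP : forall c x y, M x -> M y -> M (c *: x + y) /\
    phi (c *: x + y) = c *: phi x + phi y;
  lift_norm : forall x, M x -> N x = (n (phi x))%:E;
  lift_section : forall y, M (kappa y) /\ phi (kappa y) = y }.

Lemma ecvg0P (T : Type) (F : set_system T) {FF : Filter F} (g : T -> \bar R)
    (r : T -> R) :
  (\forall x \near F, g x = (r x)%:E /\ 0 <= r x) ->
  (g x @[x --> F] --> 0%E) <->
  (forall e, 0 < e -> \forall x \near F, r x <= e).
Proof.
move=> gr; split=> [/fine_cvgP[_ /cvgr0Pnorm_le cr] e e0|cr].
  near=> x.
  have [gx rx] : g x = (r x)%:E /\ 0 <= r x by near: x.
  have : `|(fine \o g) x| <= e by near: x; exact: cr.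
  by rewrite /= gx/= ger0_norm.
apply/fine_cvgP; split; first by apply: filterS gr => x [->].
apply/cvgr0Pnorm_le => e e0; near=> x.
have [gx rx] : g x = (r x)%:E /\ 0 <= r x by near: x.
by rewrite /= gx/= ger0_norm//; near: x; exact: cr.
Unshelve. all: by end_near. Qed.

Lemma near_addl (t : R) (P : R -> Prop) :
  (\forall s \near t, P s) -> \forall h \near (0 : R), P (t + h).
Proof.
move=> /nbhs_ballP[e /= e0 H]; apply/nbhs_ballP; exists e => //= h.
rewrite /ball/= sub0r normrN => he; apply: H.
by rewrite /ball/= opprD addrA subrr sub0r normrN.
Qed.

Lemma near_subr (t : R) (P : R -> Prop) :
  (\forall h \near (0 : R), P h) -> \forall s \near t, P (s - t).
Proof.
move=> /nbhs_ballP[e /= e0 H]; apply/nbhs_ballP; exists e => //= s.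
by rewrite /ball/= => st; apply: H; rewrite /ball/= sub0r opprB.
Qed.

Section OneLift.
Variables (V0 V : lmodType R) (M : set V0) (N : V0 -> \bar R).
Variables (n : V -> R) (phi : V0 -> V) (kappa : V -> V0).
Hypotheses (sn : seminorm n) (lft : isolift M N n phi kappa).
Implicit Types (F : R -> V0) (D x y : V0) (t : R).

Lemma liftB x y : M x -> M y -> M (x - y) /\ phi (x - y) = phi x - phi y.
Proof.
move=> Mx My; have [] := liftP lft (-1) My Mx.
by rewrite !scaleN1r ![- _ + _]addrC.
Qed.

Lemma liftZ c x : M x -> M (c *: x) /\ phi (c *: x) = c *: phi x.
Proof.
move=> Mx; have [M0 phi0] := liftB Mx Mx; rewrite !subrr in M0 phi0.
by have := liftP lft c Mx M0; rewrite phi0 !addr0.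
Qed.

Lemma liftD x y : M x -> M y -> M (x + y) /\ phi (x + y) = phi x + phi y.
Proof. by move=> Mx My; have := liftP lft 1 Mx My; rewrite !scale1r. Qed.

Lemma lift_sum k (F : 'I_k -> V0) : (forall i, M (F i)) ->
  M (\sum_i F i) /\ phi (\sum_i F i) = \sum_i phi (F i).
Proof.
elim: k F => [|k ih] F MF.
  rewrite !big_ord0; have [M0 p0] := lift_section lft 0.
  by have := liftB M0 M0; rewrite !subrr.
rewrite !big_ord_recl.
have [h1 h2] := ih _ (fun i => MF (lift ord0 i)).
by rewrite -h2; exact: liftD.
Qed.

Lemma has_derivP F t D : has_deriv M N F t D <->
  [/\ \forall s \near t, M (F s), M D & diff_at n (phi \o F) t (phi D)].
Proof.
suff H : (\forall s \near t, M (F s)) -> M D ->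
    (N (h^-1 *: (F (t + h) - F t) - D) @[h --> 0^'] --> 0%E <->
     diff_at n (phi \o F) t (phi D)).
  by split=> -[MF MD h]; split => //; apply/(H MF MD).
move=> MF MD; have MFt := nbhs_singleton MF.
have MFh := near_addl MF.
have quot h : M (F (t + h)) ->
    N (h^-1 *: (F (t + h) - F t) - D) =
    (n (h^-1 *: (phi (F (t + h)) - phi (F t)) - phi D))%:E.
  move=> MFth; have [MB pB] := liftB MFth MFt.
  have [MZ pZ] := liftZ h^-1 MB; have [MR pR] := liftB MZ MD.
  by rewrite (lift_norm lft)// pR pZ pB.
have quot_le h e : h != 0 ->
    (n (h^-1 *: (phi (F (t + h)) - phi (F t)) - phi D) <= e) =
    (n (phi (F (t + h)) - phi (F t) - h *: phi D) <= e * `|h|).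
  move=> h0; have -> : phi (F (t + h)) - phi (F t) - h *: phi D =
      h *: (h^-1 *: (phi (F (t + h)) - phi (F t)) - phi D).
    by rewrite scalerBr scalerA divff// scale1r.
  by rewrite (seminormZ sn) mulrC ler_pM2r// normr_gt0.
have nq : \forall h \near 0^',
    N (h^-1 *: (F (t + h) - F t) - D) =
    (n (h^-1 *: (phi (F (t + h)) - phi (F t)) - phi D))%:E /\
    0 <= n (h^-1 *: (phi (F (t + h)) - phi (F t)) - phi D).
  rewrite /dnbhs near_withinE; near=> h => _.
  split; last exact: seminorm_ge0 sn _.
  by apply: quot; near: h.
apply: (iff_trans (ecvg0P nq)).
split=> [H e e0|H e e0].
  have := H e e0; rewrite /dnbhs near_withinE => /near_subr-/(_ t).
  apply: filterS => s /=; have [->|st] := eqVneq s t.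
    by rewrite !subrr scale0r subr0 (seminorm0 sn) normr0 mulr0.
  rewrite subr_eq0 => /(_ st); rewrite quot_le ?subr_eq0//.
  by have -> : t + (s - t) = s by rewrite addrC subrK.
rewrite /dnbhs near_withinE; have := near_addl (H e e0).
apply: filterS => h /= He h0; rewrite quot_le//.
by move: He; rewrite [t + h - t]addrAC subrr add0r.
Unshelve. all: by end_near. Qed.

Lemma has_cderivP cont F t D : has_cderiv M N cont F t D <->
  [/\ \forall s \near t, M (F s), M D & cdiff_at cont n (phi \o F) t (phi D)].
Proof.
case: cont => /=; last first.
  apply: (iff_trans (has_derivP _ _ _)).
  by split=> -[? ?]; [move=> ?; split => //; split|move=> []].
split=> [[F' [dF' F't cF']]|[MF MD [dF /(_ isT)[G [dG Gt cG]]]]].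
  have dFt := nbhs_singleton dF'; rewrite F't in dFt.
  have [MF MD dF] := (has_derivP _ _ _).1 dFt.
  have MF' : \forall s \near t, M (F' s).
    by apply: filterS dF' => s [].
  split => //; split => // _; exists (phi \o F'); split.
  - by apply: filterS dF' => s /has_derivP[].
  - by rewrite /= F't.
  - have nB : \forall s \near t, N (F' s - D) = (n (phi (F' s) - phi D))%:E /\
        0 <= n (phi (F' s) - phi D).
      near=> s; split; last exact: seminorm_ge0 sn _.
      have MF's : M (F' s) by near: s.
      by have [MB pB] := liftB MF's MD; rewrite (lift_norm lft)// pB.
    by move/(ecvg0P nB): cF'; rewrite /cts_at /= F't.
(* kappa (G t) is only a representative of the class of D. *)
pose F' s := if s == t then D else kappa (G s).
have pF' s : M (F' s) /\ phi (F' s) = G s.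
  rewrite /F'; case: eqP => [->|_]; first by rewrite Gt.
  exact: lift_section lft _.
exists F'; split; [|by rewrite /F' eqxx|].
- near=> s; apply/has_derivP; split.
  + by near: s; exact: (near_join MF).
  + by have [] := pF' s.
  + by have [_ ->] := pF' s; near: s.
- apply/(ecvg0P (r := fun s => n (phi (F' s) - phi D))).
    near=> s; split; last exact: seminorm_ge0 sn _.
    by have [MB pB] := liftB (pF' s).1 MD; rewrite (lift_norm lft)// pB.
  move=> e e0; rewrite -Gt; near=> s; rewrite (pF' s).2.
  by near: s; exact: cG.
Unshelve. all: by end_near. Qed.

Lemma has_ncderivW m F t DF : has_ncderiv M N false m F t DF ->
  DF 0%N = F /\ forall i, (i < m)%N ->
    [/\ \forall s \near t, M (DF i s), M (DF i.+1 t) &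
        diff_at n (phi \o DF i) t (phi (DF i.+1 t))].
Proof.
elim: m => [//|m ih] /= [/nbhs_singleton/ih[DF0 dDF] /has_derivP d].
split => // i; rewrite ltnS leq_eqVlt => /predU1P[->|] //; exact: dDF.
Qed.

Lemma has_ncderiv_cdiff cont m F t DF : has_ncderiv M N cont m.+1 F t DF ->
  [/\ DF 0%N = F, forall i, (i <= m)%N -> \forall s \near t, M (DF i s),
    M (DF m.+1 t), (forall i, (i <= m)%N ->
        cdiff_at cont n (phi \o DF i) t (phi (DF i.+1 t))) &
    \forall s \near t, forall i, (i < m)%N -> 
        diff_at n (phi \o DF i) s (phi (DF i.+1 s))].
Proof.
move=> /= [nF /has_cderivP[MF MD dF]].
have nF' : \forall s \near t, DF 0%N = F /\ forall i, (i < m)%N ->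
    [/\ \forall r \near s, M (DF i r), M (DF i.+1 s) &
        diff_at n (phi \o DF i) s (phi (DF i.+1 s))].
  by apply: filterS nF => s; exact: has_ncderivW.
have [DF0 dDF] := nbhs_singleton nF'.
have dd : \forall s \near t, forall i, (i < m)%N ->
    diff_at n (phi \o DF i) s (phi (DF i.+1 s)).
  by apply: filterS nF' => s [_ h] i /h[].
split => //.
- by move=> i; rewrite leq_eqVlt => /predU1P[->//|/dDF[]].
- move=> i; rewrite leq_eqVlt => /predU1P[->//|im].
  have [Mi MDi di] := dDF _ im; split => // _.
  exists (fun s => phi (DF i.+1 s)); split => //.
  + by apply: filterS dd => s; apply.
  + apply: (@diff_cts _ _ _ sn _ _ (phi (DF i.+2 t))).
    move: im; rewrite leq_eqVlt => /predU1P[->|/dDF[]//].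
    by case: dF.
Qed.

Lemma diff_has_ncderiv m F t DF : DF 0%N = F ->
  (\forall s \near t, forall i, (i <= m)%N -> M (DF i s)) ->
  (\forall s \near t, forall i, (i < m)%N ->
     diff_at n (phi \o DF i) s (phi (DF i.+1 s))) ->
  has_ncderiv M N false m F t DF.
Proof.
move=> DF0; elim: m t => [//|m ih] t MF dF /=.
split; last first.
  apply/has_derivP; split.
  - by apply: filterS MF => s; apply; exact: leqnSn.
  - by apply: (nbhs_singleton MF).
  - by apply: (nbhs_singleton dF).
near=> s; apply: ih.
- have : \forall r \near s, forall i, (i <= m.+1)%N -> M (DF i r).
    by near: s; exact: (near_join MF).
  by apply: filterS => r h i im; apply: h; exact: ltnW.
- have : \forall r \near s, forall i, (i < m.+1)%N ->
      diff_at n (phi \o DF i) r (phi (DF i.+1 r)).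
    by near: s; exact: (near_join dF).
  by apply: filterS => r h i im; apply: h; exact: ltnW.
Unshelve. all: by end_near. Qed.

Lemma cdiff_has_ncderiv cont m F t DF : DF 0%N = F ->
  (\forall s \near t, forall i, (i <= m)%N -> M (DF i s)) -> M (DF m.+1 t) ->
  (\forall s \near t, forall i, (i < m)%N ->
     diff_at n (phi \o DF i) s (phi (DF i.+1 s))) ->
  cdiff_at cont n (phi \o DF m) t (phi (DF m.+1 t)) ->
  has_ncderiv M N cont m.+1 F t DF.
Proof.
move=> DF0 MF MDF dF cdF /=; split; last first.
  by apply/has_cderivP; split => //; apply: filterS MF => s; exact.
near=> s; apply: diff_has_ncderiv => //.
- by near: s; exact: (near_join MF).
- by near: s; exact: (near_join dF).
Unshelve. all: by end_near. Qed.

Lemma has_ncderiv_cst cont m x t : M x ->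
  has_ncderiv M N cont m.+1 (fun=> x) t (fun j _ => if j is 0%N then x else 0).
Proof.
move=> Mx; have [M0 p0] := liftB Mx Mx; rewrite !subrr in M0 p0.
apply: cdiff_has_ncderiv => //.
- by near=> s => -[|i].
- by near=> s => -[|i] _; rewrite p0; exact: diff_cst.
- by rewrite p0; case: m => [|m]; exact: cdiff_cst.
Unshelve. all: by end_near. Qed.

End OneLift.

Section Leibniz.
Variables (U0 V0 U V : lmodType R).
Variables (MU : set U0) (NU : U0 -> \bar R) (MV : set V0) (NV : V0 -> \bar R).
Variables (nU : U -> R) (phiU : U0 -> U) (kappaU : U -> U0).
Variables (nV : V -> R) (phiV : V0 -> V) (kappaV : V -> V0).
Hypotheses (snU : seminorm nU) (snV : seminorm nV).
Hypotheses (lU : isolift MU NU nU phiU kappaU).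
Hypotheses (lV : isolift MV NV nV phiV kappaV).
Variable act : U -> V -> V.
Hypotheses (actBl : forall p q y, act (p - q) y = act p y - act q y)
  (actZl : forall c q y, act (c *: q) y = c *: act q y)
  (actBr : forall q y z, act q (y - z) = act q y - act q z)
  (actZr : forall c q y, act q (c *: y) = c *: act q y)
  (act_le : forall q y, nV (act q y) <= nU q * nV y).
Variables (K : R -> U0) (f u : R -> V0) (B : R) (Gop : R -> V -> V) (t : R).
Hypothesis rs : \forall s \near t, resolved nV act (phiU \o K) B Gop s.
Hypothesis solu : \forall s \near t,
  MV (u s) /\ solves act (phiU \o K) (phiV \o u) (phiV \o f) s.

Lemma has_cderiv_solution cont K' f' v :
  has_cderiv MU NU cont K t K' -> has_cderiv MV NV cont f t f' -> MV v ->
  phiV v = phiV f' + act (phiU K') (phiV (u t)) + act (phiU (K t)) (phiV v) ->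
  has_cderiv MV NV cont u t v.
Proof.
move=> /(has_cderivP snU lU)[MK MK' dK] /(has_cderivP snV lV)[Mf Mf' df] Mv ve.
apply/(has_cderivP snV lV); split => //; first by apply: filterS solu => s [].
apply: (cdiff_solution snU snV actBl actZl actBr actZr act_le rs _ dK df ve).
by apply: filterS solu => s [].
Qed.

Section Table.
Variables (DK : nat -> R -> U) (Df : nat -> R -> V) (u0 : R -> V).

(** Course-of-values recursion: the entry of order k is computed from the row
    before, which already contains all the entries of lower order. *)
Fixpoint leibniz_table k : nat -> R -> V :=
  if k is k'.+1 then fun j =>
    if (j <= k')%N then leibniz_table k' j
    else fun s => Gop s (leibniz_rhs act DK Df (leibniz_table k') k s)
  else fun=> u0.

Definition leibniz_deriv j := leibniz_table j j.

Lemma leibniz_tableE k j : (j <= k)%N -> leibniz_table k j = leibniz_deriv j.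
Proof.
elim: k => [|k ih]; first by case: j.
rewrite leq_eqVlt => /predU1P[->//|jk].
by rewrite /= -ltnS jk ih.
Qed.

Lemma leibniz_derivS k s :
  leibniz_deriv k.+1 s = Gop s (leibniz_rhs act DK Df leibniz_deriv k.+1 s).
Proof.
rewrite /leibniz_deriv /= ltnn /leibniz_rhs; congr (Gop s (_ + _)).
by apply: eq_bigr => j _; rewrite leibniz_tableE// -ltnS ltn_ord.
Qed.

End Table.

(** The derivatives of order j > 0 are taken to be the chosen representatives
    of the solutions of the equations of order j, while order 0 has to be u
    itself. *)
Lemma has_ncderiv_solution cont m DK Df :
  has_ncderiv MU NU cont m.+1 K t DK -> has_ncderiv MV NV cont m.+1 f t Df ->
  exists2 Du, has_ncderiv MV NV cont m.+1 u t Du &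
    (forall j, (j <= m)%N -> MV (Du j t)) /\
    Du m.+1 t = kappaV (Gop t (leibniz_rhs act (fun j => phiU \o DK j)
      (fun j => phiV \o Df j) (fun j => phiV \o Du j) m.+1 t)).
Proof.
move=> /(has_ncderiv_cdiff snU lU)[DK0 MK _ dK nK].
move=> /(has_ncderiv_cdiff snV lV)[Df0 Mf _ df nf].
pose DK' j := phiU \o DK j; pose Df' j := phiV \o Df j.
pose d := leibniz_deriv DK' Df' (phiV \o u).
pose Du j := if j is 0%N then u else kappaV \o d j.
have DuE j : phiV \o Du j = d j.
  by case: j => [//|j]; apply/funext => s; exact: (lift_section lV _).2.
have sd : \forall s \near t, forall n,
    solves act (phiU \o K) (d n) (leibniz_rhs act DK' Df' d n) s.
  near=> s => -[|n].
    rewrite /solves /leibniz_rhs big_ord0 addr0 /Df' Df0.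
    suff : MV (u s) /\ solves act (phiU \o K) (phiV \o u) (phiV \o f) s by case.
    by near: s.
  rewrite /solves /d leibniz_derivS.
  suff : resolved nV act (phiU \o K) B Gop s by case.
  by near: s.
have MDu : \forall s \near t, forall i, (i <= m)%N -> MV (Du i s).
  near=> s => -[_|i _] /=; last exact: (lift_section lV _).1.
  suff : MV (u s) /\ solves act (phiU \o K) (phiV \o u) (phiV \o f) s by case.
  by near: s.
have K0 : DK' 0%N = phiU \o K by rewrite /DK' DK0.
exists Du; last first.
  split; first exact: (nbhs_singleton MDu).
  rewrite /= /d leibniz_derivS; congr (kappaV (Gop t (_ + _))).
  by apply: eq_bigr => j _; rewrite -/d -DuE.
apply: (cdiff_has_ncderiv snV lV) => //.
- exact: (lift_section lV _).1.
- near=> s => i im; rewrite DuE.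
  have -> : phiV (Du i.+1 s) = d i.+1 s by exact: (congr1 (@^~ s) (DuE i.+1)).
  suff /(_ i (leqnn i))[dd _] : forall k, (k <= i)%N ->
      cdiff_at false nV (d k) s (d k.+1 s) by exact: dd.
  apply: (@cdiff_leibniz _ _ _ _ _ snU snV _ actBl actZl actBr actZr act_le
     (phiU \o K) B Gop false i s DK' Df' d) => //.
  + by near: s; exact: (near_join rs).
  + by near: s; exact: (near_join sd).
  + move=> j ji; split => //; have := leq_ltn_trans ji im; move: (j).
    by near: s.
  + move=> j ji; split => //; have := leq_ltn_trans ji im; move: (j).
    by near: s.
- rewrite DuE.
  have -> : phiV (Du m.+1 t) = d m.+1 t by exact: (congr1 (@^~ t) (DuE m.+1)).
  by apply: (@cdiff_leibniz _ _ _ _ _ snU snV _ actBl actZl actBr actZr act_le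
     (phiU \o K) B Gop cont m t DK' Df' d).
Unshelve. all: by end_near. Qed.

End Leibniz.
End Transfer.
(** * Weighted functions and operators *)

Section WeightedFunctions.
Context {d : measure_display} {S : measurableType d} {R : realType}.
Variables (C : set S) (w : S -> R).

(** The elements of L_w, normalized to vanish outside C so that equality of
    functions on C becomes equality. *)
Definition wfun_pred : {pred S -> R} := fun h => `[< [/\ measurable_fun C h,
  forall x, ~ C x -> h x = 0 &
  exists k, forall x, C x -> `|h x| <= k * w x] >].

Lemma wfun_submod_closed : submod_closed wfun_pred.
Proof.
split.
  apply/asboolP; split => //; first exact: measurable_cst.
  by exists 0 => x _; rewrite normr0 mul0r.
move=> c h1 h2 /asboolP[m1 z1 [k1 b1]] /asboolP[m2 z2 [k2 b2]].
apply/asboolP; split.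
- by apply: measurable_funD => //; apply: measurable_funM => //; exact: measurable_cst.
- by move=> x Cx; rewrite /= !fctE z1// z2// scaler0 addr0.
- exists (`|c| * k1 + k2) => x Cx; rewrite !fctE.
  apply: (le_trans (ler_normD _ _)); rewrite mulrDl; apply: lerD; last exact: b2.
  by rewrite normrM -mulrA ler_wpM2l//; exact: b1.
Qed.

HB.instance Definition _ :=
  GRing.isSubmodClosed.Build R (S -> R) wfun_pred wfun_submod_closed.

Record wfun := WFun { wfun_fun :> S -> R; wfun_subproof : wfun_fun \in wfun_pred }.

HB.instance Definition _ := [isSub for wfun_fun].
HB.instance Definition _ := [Choice of wfun by <:].
HB.instance Definition _ := [SubChoice_isSubLmodule of wfun by <:].

Implicit Types h : wfun.

Lemma wfunP h1 h2 : (forall x, C x -> h1 x = h2 x) -> h1 = h2.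
Proof.
move=> h12; apply/val_inj/funext => x /=.
have [Cx|nCx] := pselect (C x); first exact: h12.
have /asboolP[_ z1 _] := wfun_subproof h1.
by have /asboolP[_ z2 _] := wfun_subproof h2; rewrite z1// z2.
Qed.

Lemma wfunD h1 h2 x : (h1 + h2) x = h1 x + h2 x. Proof. by []. Qed.
Lemma wfunZ c h x : (c *: h) x = c * h x. Proof. by []. Qed.

Lemma wfun_sum I (r : seq I) (P : pred I) (F : I -> wfun) x :
  (\sum_(i <- r | P i) F i) x = \sum_(i <- r | P i) F i x.
Proof. by elim/big_rec2 : _ => // i y1 y2 _ <-. Qed.

Lemma wfun_meas h : measurable_fun C h.
Proof. by have /asboolP[] := wfun_subproof h. Qed.

(** These are exactly the operators that arise from kernels: continuity along
    dominated pointwise convergence is what makes B |-> T 1_B (x) countably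
    additive. *)
Definition kop_pred : {pred wfun -> wfun} := fun T => `[< [/\
  forall c h1 h2, T (c *: h1 + h2) = c *: T h1 + T h2,
  exists2 k, 0 <= k & forall h b, 0 <= b ->
    (forall x, C x -> `|h x| <= b * w x) ->
    forall x, C x -> `|T h x| <= k * b * w x &
  forall (h_ : nat -> wfun) h b, 0 <= b ->
    (forall n x, C x -> `|h_ n x| <= b * w x) ->
    (forall x, C x -> h_ n x @[n --> \oo] --> h x) ->
    forall x, C x -> T (h_ n) x @[n --> \oo] --> T h x] >].

Lemma kop_submod_closed : submod_closed kop_pred.
Proof.
split.
  apply/asboolP; split.
  - by move=> c h1 h2; rewrite scaler0 addr0.
  - by exists 0 => // h b _ _ x _; rewrite /= normr0 !mul0r.
  - by move=> h_ h b _ _ _ x _; exact: cvg_cst.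
move=> c T1 T2 /asboolP[l1 [k1 k10 b1] s1] /asboolP[l2 [k2 k20 b2] s2].
apply/asboolP; split.
- move=> a h1 h2; rewrite !fctE l1 l2 !scalerDr !scalerA [c * a]mulrC.
  by rewrite addrACA -!scalerA.
- exists (`|c| * k1 + k2); first by rewrite addr_ge0// mulr_ge0.
  move=> h b b0 hb x Cx; rewrite !fctE wfunD wfunZ.
  apply: (le_trans (ler_normD _ _)); rewrite !mulrDl; apply: lerD; last exact: b2.
  by rewrite normrM -!mulrA ler_wpM2l// mulrA; exact: b1.
- move=> h_ h b b0 hb hc x Cx; rewrite !fctE wfunD wfunZ.
  by apply: cvgD; [apply: cvgMr; exact: s1 b0 hb hc _ Cx|exact: s2 b0 hb hc _ Cx].
Qed.

HB.instance Definition _ :=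
  GRing.isSubmodClosed.Build R (wfun -> wfun) kop_pred kop_submod_closed.

Record kop := KOp { kop_fun :> wfun -> wfun; kop_subproof : kop_fun \in kop_pred }.

HB.instance Definition _ := [isSub for kop_fun].
HB.instance Definition _ := [Choice of kop by <:].
HB.instance Definition _ := [SubChoice_isSubLmodule of kop by <:].

Implicit Types T : kop.

Lemma kopP T1 T2 : (forall h x, C x -> T1 h x = T2 h x) -> T1 = T2.
Proof.
by move=> T12; apply/val_inj/funext => h /=; apply: wfunP => x; exact: T12.
Qed.

Lemma kop_linear T c h1 h2 : T (c *: h1 + h2) = c *: T h1 + T h2.
Proof. by have /asboolP[] := kop_subproof T. Qed.

Lemma kopB T h1 h2 : T (h1 - h2) = T h1 - T h2.
Proof.
by rewrite -[- h2]scaleN1r addrC kop_linear scaleN1r addrC.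
Qed.

Lemma kop0 T : T 0 = 0.
Proof. by have := kopB T 0 0; rewrite !subrr. Qed.

Lemma kopZ T c h : T (c *: h) = c *: T h.
Proof.
by rewrite -[c *: h]addr0 kop_linear kop0 addr0.
Qed.

Lemma kopD T h1 h2 : T (h1 + h2) = T h1 + T h2.
Proof. by rewrite -[h1]scale1r kop_linear !scale1r. Qed.

Lemma kop_sum T I (r : seq I) (P : pred I) (F : I -> wfun) :
  T (\sum_(i <- r | P i) F i) = \sum_(i <- r | P i) T (F i).
Proof.
by elim/big_rec2 : _ => [|i y1 y2 _ <-]; [exact: kop0|rewrite kopD].
Qed.

Lemma kop_bound T : exists2 k, 0 <= k & forall h b, 0 <= b ->
  (forall x, C x -> `|h x| <= b * w x) ->
  forall x, C x -> `|T h x| <= k * b * w x.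
Proof.
by have /asboolP[] := kop_subproof T.
Qed.

Lemma kop_cvg T (h_ : nat -> wfun) h b : 0 <= b ->
  (forall n x, C x -> `|h_ n x| <= b * w x) ->
  (forall x, C x -> h_ n x @[n --> \oo] --> h x) ->
  forall x, C x -> T (h_ n) x @[n --> \oo] --> T h x.
Proof. by have /asboolP[_ _ +] := kop_subproof T; apply. Qed.

Lemma kopDE T1 T2 h : (T1 + T2) h = T1 h + T2 h. Proof. by []. Qed.
Lemma kopNE T h : (- T) h = - T h. Proof. by []. Qed.
Lemma kopZE c T h : (c *: T) h = c *: T h. Proof. by []. Qed.

Lemma kop_id_subproof : (id : wfun -> wfun) \in kop_pred.
Proof.
apply/asboolP; split => //.
by exists 1 => // h b _ hb x Cx; rewrite mul1r; exact: hb.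
Qed.

Definition kop_id : kop := KOp kop_id_subproof.

Lemma kop_comp_subproof T1 T2 : (T1 \o T2 : wfun -> wfun) \in kop_pred.
Proof.
have [k1 k10 b1] := kop_bound T1; have [k2 k20 b2] := kop_bound T2.
apply/asboolP; split.
- by move=> c h1 h2 /=; rewrite !kop_linear.
- exists (k1 * k2); first exact: mulr_ge0.
  move=> h b b0 hb x Cx; rewrite -(mulrA k1).
  by apply: b1 => //; [exact: mulr_ge0|exact: b2].
- move=> h_ h b b0 hb hc; apply: (@kop_cvg T1 (fun n => T2 (h_ n)) (T2 h) (k2 * b)).
  + exact: mulr_ge0.
  + by move=> n x Cx; exact: b2 (hb n) _ Cx.
  + exact: kop_cvg b0 hb hc.
Qed.

Definition kop_comp T1 T2 : kop := KOp (kop_comp_subproof T1 T2).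

End WeightedFunctions.
(** * Norms, truncation to C, indicators *)

Lemma seminormW {R : realType} (V : lmodType R) (n : V -> R) :
  (forall x, 0 <= n x) -> (forall x y, n (x + y) <= n x + n y) ->
  (forall c x, n (c *: x) <= `|c| * n x) -> seminorm n.
Proof.
move=> n0 nD nZ; split => // c x; apply/eqP; rewrite eq_le nZ/=.
have [->|c0] := eqVneq c 0; first by rewrite normr0 mul0r.
rewrite -{1}(scale1r x) -(mulVf c0) -scalerA.
apply: (@le_trans _ _ (`|c| * (`|c^-1| * n (c *: x)))).
  by rewrite ler_wpM2l.
by rewrite mulrA -normrM divff// normr1 mul1r.
Qed.

Section Norms.
Import HBSimple HBNNSimple.
Context {d : measure_display} {S : measurableType d} {R : realType}.
Variables (C : set S) (w : S -> R).
Hypotheses (mC : measurable C) (mw : measurable_fun C w).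
Hypothesis w_ge1 : forall x, C x -> 1 <= w x.
Local Notation X := (wfun C w).

Lemma w_gt0 x : C x -> 0 < w x.
Proof. by move=> /w_ge1; exact: lt_le_trans. Qed.

Lemma sup0_ge0 (E : set (\bar R)) : (0 <= Defs.sup0 E)%E.
Proof. by rewrite /Defs.sup0 le_max lexx. Qed.

Lemma sup0_ge (E : set (\bar R)) y : E y -> (y <= Defs.sup0 E)%E.
Proof. by move=> Ey; rewrite /Defs.sup0 le_max ereal_sup_ubound ?orbT. Qed.

Lemma sup0_le (E : set (\bar R)) k : (0 <= k)%E ->
  (forall y, E y -> (y <= k)%E) -> (Defs.sup0 E <= k)%E.
Proof. by move=> k0 Ek; rewrite /Defs.sup0 ge_max k0/=; exact: ge_ereal_sup. Qed.

Lemma ewnorm_leP (h : S -> \bar R) k : 0 <= k ->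
  (ewnorm C w h <= k%:E)%E <->
  forall x, C x -> (`|h x| <= (k * w x)%:E)%E.
Proof.
move=> k0.
have divE x : C x -> (`|h x| / (w x)%:E <= k%:E)%E = (`|h x| <= (k * w x)%:E)%E.
  move=> Cx; rewrite inver gt_eqF ?w_gt0// lee_pdivrMr ?w_gt0//.
split=> [hk x Cx|hk].
  by rewrite -divE//; apply: le_trans hk; apply: sup0_ge; exists x.
apply: sup0_le; first by rewrite lee_fin.
by move=> _ [x Cx <-]; rewrite divE//; exact: hk.
Qed.

Lemma wnorm_leP (h : S -> R) k : 0 <= k ->
  (wnorm C w h <= k%:E)%E <-> forall x, C x -> `|h x| <= k * w x.
Proof.
by move=> k0; rewrite /wnorm ewnorm_leP//; split=> hk x /hk; rewrite lee_fin.
Qed.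

Lemma wnorm_ge0 (h : S -> R) : (0 <= wnorm C w h)%E.
Proof. exact: sup0_ge0. Qed.

Lemma LwE (h : S -> R) : Lw C w h -> wnorm C w h = (fine (wnorm C w h))%:E.
Proof. by move=> [_ h1]; rewrite fineK// ge0_fin_numE// wnorm_ge0. Qed.

Lemma LwP (h : S -> R) : Lw C w h <-> measurable_fun C h /\
  exists2 k, 0 <= k & forall x, C x -> `|h x| <= k * w x.
Proof.
split=> [Lh|[mh [k k0 hk]]]; last first.
  split => //; have /wnorm_leP-/(_ k0) := hk.
  by move=> /le_lt_trans; apply; rewrite ltry.
split; first by case: Lh.
exists (fine (wnorm C w h)); first by rewrite fine_ge0// wnorm_ge0.
by apply/wnorm_leP; rewrite ?fine_ge0 ?wnorm_ge0// -LwE.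
Qed.

Lemma Lw_wfun (h : X) : Lw C w h.
Proof.
have /asboolP[mh _ [k hk]] := wfun_subproof h.
apply/LwP; split => //; exists `|k| => // x Cx; apply: (le_trans (hk x Cx)).
by rewrite ler_wpM2r ?ler_norm// ltW// w_gt0.
Qed.

Definition wn (h : X) : R := fine (wnorm C w h).

Lemma wn_ge0 (h : X) : 0 <= wn h.
Proof. by rewrite fine_ge0// wnorm_ge0. Qed.

Lemma wn_leP (h : X) k : 0 <= k -> wn h <= k <-> forall x, C x -> `|h x| <= k * w x.
Proof. by move=> k0; rewrite -wnorm_leP// (LwE (Lw_wfun h)) lee_fin. Qed.

Lemma wn_bound (h : X) x : C x -> `|h x| <= wn h * w x.
Proof. by move: x; apply/wn_leP => //; exact: wn_ge0. Qed.

Lemma seminorm_wn : seminorm wn.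
Proof.
apply: seminormW; first exact: wn_ge0.
- move=> h1 h2; apply/wn_leP; first by rewrite addr_ge0 ?wn_ge0.
  move=> x Cx; rewrite wfunD mulrDl (le_trans (ler_normD _ _))//.
  by rewrite lerD// wn_bound.
- move=> c h; apply/wn_leP; first by rewrite mulr_ge0 ?wn_ge0.
  by move=> x Cx; rewrite wfunZ normrM -mulrA ler_wpM2l// wn_bound.
Qed.

Lemma restrict_subproof (h : S -> R) : Lw C w h -> h \_ C \in wfun_pred C w.
Proof.
move=> /LwP[mh [k k0 hk]]; apply/asboolP; split.
- by apply: eq_measurable_fun mh => x xC; rewrite patchE xC.
- by move=> x Cx; rewrite patchE memNset.
- by exists k => x Cx; rewrite patchE mem_set//; exact: hk.
Qed.

(** Total, with junk value 0 outside L_w, so that it can be composed with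
    arbitrary families of functions. *)
Definition cut (h : S -> R) : X :=
  if pselect (Lw C w h) is left p then WFun (restrict_subproof p) else 0.

Lemma cutE h x : Lw C w h -> C x -> cut h x = h x.
Proof.
by move=> Lh Cx; rewrite /cut; case: pselect => //= _; rewrite patchE mem_set.
Qed.

Lemma cutK (h : X) : cut h = h.
Proof. by apply: wfunP => x Cx; rewrite cutE//; exact: Lw_wfun. Qed.

Lemma LwD c (h1 h2 : S -> R) : Lw C w h1 -> Lw C w h2 -> Lw C w (c *: h1 + h2).
Proof.
move=> /LwP[m1 [k1 k10 b1]] /LwP[m2 [k2 k20 b2]]; apply/LwP; split.
  by apply: measurable_funD => //; apply: measurable_funM => //; exact: measurable_cst.
exists (`|c| * k1 + k2); first by rewrite addr_ge0// mulr_ge0.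
move=> x Cx; rewrite !fctE.
apply: (le_trans (ler_normD _ _)); rewrite mulrDl; apply: lerD; last exact: b2.
by rewrite normrM -mulrA ler_wpM2l//; exact: b1.
Qed.

Lemma eq_Lw (h1 h2 : S -> R) : (forall x, C x -> h1 x = h2 x) -> Lw C w h1 -> Lw C w h2.
Proof.
move=> h12 /LwP[m1 [k1 k10 b1]]; apply/LwP; split.
  by apply: eq_measurable_fun m1 => x /set_mem; exact: h12.
by exists k1 => // x Cx; rewrite -h12//; exact: b1.
Qed.

Lemma eq_cut (h1 h2 : S -> R) : Lw C w h1 -> (forall x, C x -> h1 x = h2 x) ->
  cut h1 = cut h2.
Proof.
move=> L1 h12; apply: wfunP => x Cx; rewrite !cutE//; first exact: h12.
exact: eq_Lw L1.
Qed.

Lemma eq_wnorm (h1 h2 : S -> R) : (forall x, C x -> h1 x = h2 x) ->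
  wnorm C w h1 = wnorm C w h2.
Proof.
move=> h12; rewrite /wnorm /ewnorm; congr (Defs.sup0 _).
by apply: eq_imagel => x Cx /=; rewrite h12.
Qed.

Lemma isolift_Lw : isolift (Lw C w) (wnorm C w) wn cut (@wfun_fun _ _ _ C w).
Proof.
split.
- move=> c x y Lx Ly; have Lxy := LwD c Lx Ly; split => //.
  by apply: wfunP => z Cz; rewrite wfunD wfunZ !cutE.
- move=> h Lh; rewrite LwE// /wn; congr (fine _)%:E.
  by apply: eq_wnorm => x Cx; rewrite cutE.
- by move=> h; split; [exact: Lw_wfun|exact: cutK].
Qed.

Lemma Lw_indic (B : set S) : measurable B -> Lw C w \1_B.
Proof.
move=> mB; apply/LwP; split; first exact: measurable_indic.
exists 1 => // x Cx; rewrite mul1r ger0_norm ?(le_trans _ (w_ge1 Cx))//.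
Qed.

Definition ind (B : set S) : X := cut \1_B.

Lemma indE B x : measurable B -> C x -> ind B x = \1_B x.
Proof. by move=> mB Cx; rewrite cutE//; exact: Lw_indic. Qed.

(** Induction over simple functions: a nonnegative function is the increasing
    limit of nonnegative simple ones, which lie in L_w since they are smaller. *)
Lemma wfun_ind (P : X -> Prop) :
  (forall B, measurable B -> P (ind B)) ->
  (forall c (h1 h2 : X), 0 <= c -> (forall x, C x -> 0 <= h1 x) ->
    (forall x, C x -> 0 <= h2 x) -> P h1 -> P h2 -> P (c *: h1 + h2)) ->
  (forall (h_ : nat -> X) (h : X), (forall n, P (h_ n)) ->
    (forall n x, C x -> 0 <= h_ n x <= h x) ->
    (forall x, C x -> {homo (fun n => h_ n x) : m n / (m <= n)%N >-> m <= n}) ->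
    (forall x, C x -> h_ n x @[n --> \oo] --> h x) -> P h) ->
  forall h : X, (forall x, C x -> 0 <= h x) -> P h.
Proof.
move=> Pind PD Plim h h0.
have mh : measurable_fun C (EFin \o h) by apply/measurable_EFinP; exact: wfun_meas.
have [g [ndg cg]] := approximation mC mh (fun x Cx => h0 x Cx).
have cgr x : C x -> g n x @[n --> \oo] --> h x.
  by move=> Cx; have := cg x Cx; rewrite /= => /fine_cvgP[_].
have ndgx x : nondecreasing_seq (g^~ x).
  by move=> m n mn; have /lefP := ndg _ _ mn; exact.
have gh n x : C x -> g n x <= h x.
  move=> Cx; have /cvg_lim <- // := cgr x Cx.
  by apply: nondecreasing_cvgn_le => //; apply/cvg_ex; exists (h x); exact: cgr.
have mg n : measurable_fun C (g n) by exact: measurable_funTS.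
have Lg n : Lw C w (g n).
  have /LwP[_ [k k0 hk]] := Lw_wfun h.
  apply/LwP; split => //; exists k => // x Cx.
  rewrite ger0_norm// (le_trans (gh _ _ Cx))// (le_trans _ (hk _ Cx))//.
  exact: ler_norm.
apply: (Plim (fun n => cut (g n))).
- move=> n.
  have [s us rs] : exists2 s : seq R, uniq s & range (g n) = [set` s].
    have /finite_seqP[s rs] : finite_set (range (g n)) by exact: fimfunP.
    exists (undup s); first exact: undup_uniq.
    by rewrite rs; apply/seteqP; split => y /=; rewrite mem_undup.
  have -> : cut (g n) = \sum_(i < size s) s`_i *: ind (g n @^-1` [set s`_i]).
    apply: wfunP => x Cx; rewrite cutE// wfun_sum fimfunE rs -fsbig_seq//.
    rewrite (big_nth 0) big_mkord.
    by apply: eq_bigr => i _; rewrite -[RHS]/(s`_i * ind _ x) indE.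
  have s0 i : (i < size s)%N -> 0 <= s`_i.
    move=> /(mem_nth 0) si; have : [set` s] s`_i by [].
    by rewrite -rs => -[y _ <-].
  suff : forall N (c : 'I_N -> R) (B : 'I_N -> set S), (forall i, 0 <= c i) ->
      (forall i, measurable (B i)) ->
      (forall x, C x -> 0 <= (\sum_i c i *: ind (B i)) x) /\
      P (\sum_i c i *: ind (B i)).
    move=> /(_ _ (fun i : 'I_(size s) => s`_i)
      (fun i => g n @^-1` [set s`_i])) [] //.
    by move=> i; apply: s0.
  elim=> [|N ih] c B c0 mB.
    rewrite !big_ord0; split => //.
    suff <- : ind set0 = 0 by exact: Pind.
    by apply: wfunP => x Cx; rewrite indE// indic0.
  rewrite !big_ord_recl.
  have [s1 s2] := ih (fun i => c (lift ord0 i)) (fun i => B (lift ord0 i))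
    (fun i => c0 _) (fun i => mB _).
  have i0 x : C x -> 0 <= ind (B ord0) x by move=> Cx; rewrite indE.
  split; last by apply: PD => //; exact: Pind.
  by move=> x Cx; rewrite wfunD wfunZ addr_ge0//; [rewrite mulr_ge0// i0|exact: s1].
- by move=> n x Cx; rewrite cutE// gh// andbT.
- by move=> x Cx m n mn; rewrite !cutE//; exact: ndgx.
- by move=> x Cx; under eq_fun do rewrite cutE//; exact: cgr.
Qed.

End Norms.
(** * Integration against signed measures *)

Section SignedIntegral.
Context {d : measure_display} {S : measurableType d} {R : realType}.
Local Open Scope ereal_scope.
Import HBSimple HBNNSimple.

Lemma eq_set_integral (m1 m2 : set S -> \bar R) (D : set S) (f : S -> \bar R) :
  (forall A, measurable A -> m1 A = m2 A) ->
  \int[m1]_(x in D) f x = \int[m2]_(x in D) f x.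
Proof.
move=> m12; have sE (h : {nnsfun S >-> R}) : sintegral m1 h = sintegral m2 h.
  by apply: eq_fsbigr => x _; rewrite m12.
rewrite /integral; congr (ereal_sup _ - ereal_sup _);
  by apply: eq_imagel => h _; exact: sE.
Qed.

(** The supremum is reached on the intersection with the positive set P. *)
Lemma upper_variation_jordan (C : set S) (nu : set S -> R)
    (p n : {measure set S -> \bar R}) (P : set S) :
  measurable C -> measurable P ->
  (forall B, measurable B -> B `<=` C -> (nu B)%:E = p B - n B) ->
  (forall B, measurable B -> n B < +oo) ->
  (forall B, measurable B -> p B = (nu (B `&` C `&` P))%:E) ->
  forall B, measurable B -> upper_variation C nu B = p B.
Proof.
move=> mC mP nuE nfin pE B mB; apply/eqP; rewrite eq_le; apply/andP; split.
  apply: ge_ereal_sup => _ [B' [mB' BC] <-].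
  rewrite nuE//; last by apply: subset_trans BC _; exact: subIsetr.
  apply: (@le_trans _ _ (p B')); last first.
    by apply: le_measure; rewrite ?inE//; apply: subset_trans BC _; exact: subIsetl.
  by rewrite leeBlDr ?ge0_fin_numE ?nfin// leeDl.
rewrite pE//; apply: ereal_sup_ubound; exists (B `&` C `&` P) => //; split.
  by apply: measurableI => //; exact: measurableI.
exact: subIsetl.
Qed.

(** Both variations are measures once they are computed from a Hahn
    decomposition of the charge restricted to C, and then the integral against
    them enjoys the usual theory. *)
Lemma signed_integral_jordan (C : set S) (nu : set S -> R)
    (m : {charge set S -> \bar R}) : measurable C ->
  (forall B, measurable B -> B `<=` C -> (nu B)%:E = m B) ->
  exists (p n : {measure set S -> \bar R}) (P N : set S),
    measurable P /\ measurable N /\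
    [/\ P `|` N = setT /\ P `&` N = set0,
      forall B, measurable B -> p B = (nu (B `&` C `&` P))%:E,
      forall B, measurable B -> n B = (- nu (B `&` C `&` N))%:E,
      forall B, measurable B -> B `<=` C -> (nu B)%:E = p B - n B &
      forall h, signed_integral C nu h =
        \int[p]_(y in C) (h y)%:E - \int[n]_(y in C) (h y)%:E].
Proof.
move=> mC num.
pose mu : {charge set S -> \bar R} := crestr0 m mC.
have [P [N PN]] := Hahn_decomposition mu.
have [[mP _] [mN _] PUN PIN] := PN.
have muE B : measurable B -> mu B = (nu (B `&` C))%:E.
  move=> mB; rewrite num//; last exact: measurableI.
  by rewrite /mu/= /crestr0 mem_set.
pose p : {measure set S -> \bar R} := jordan_pos PN.
pose n : {measure set S -> \bar R} := jordan_neg PN.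
have pE B : measurable B -> p B = (nu (B `&` C `&` P))%:E.
  move=> mB; rewrite /p/= jordan_posE cjordan_posE /crestr0 mem_set// /crestr.
  by rewrite muE; [rewrite setIAC|exact: measurableI].
have nE B : measurable B -> n B = (- nu (B `&` C `&` N))%:E.
  move=> mB; rewrite /n/= jordan_negE cjordan_negE /crestr0 mem_set// /crestr.
  by rewrite muE; [rewrite setIAC|exact: measurableI].
have nuE B : measurable B -> B `<=` C -> (nu B)%:E = p B - n B.
  move=> mB BC; have -> : (nu B)%:E = mu B by rewrite muE// (setIidl BC).
  by rewrite (jordan_decomp PN mB) /cadd/= cscaleN1.
exists p, n, P, N; do 3! split => //; move=> h; rewrite /signed_integral.
congr (_ - _); apply: eq_set_integral.
  apply: (@upper_variation_jordan _ _ p n P) => //.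
  by move=> B mB; rewrite nE// ltry.
apply: (@upper_variation_jordan _ _ n p N) => //.
- move=> B mB BC; rewrite -[LHS]/((- nu B)%:E) EFinN nuE// pE// nE//.
  by rewrite -!EFinB -EFinN opprB.
- by move=> B mB; rewrite pE// ltry.
Qed.

End SignedIntegral.

Section Representation.
Context {d : measure_display} {S : measurableType d} {R : realType}.
Variables (C : set S) (w : S -> R).
Hypotheses (mC : measurable C) (mw : measurable_fun C w).
Hypothesis w_ge1 : forall x, C x -> 1 <= w x.
Local Notation X := (wfun C w).
Local Notation ind := (ind w_ge1).
Local Notation cut := (cut w_ge1).

(** Uniqueness part of Daniell's theorem: a measure and a functional that agree
    on indicators agree on L_w, by simple approximation. Integrability of h
    follows from the finiteness of L at |h|. *)
Lemma daniell (mu : {measure set S -> \bar R}) (L : X -> R) :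
  (forall c h1 h2, L (c *: h1 + h2) = c * L h1 + L h2) ->
  (forall (h_ : nat -> X) (h : X) b, 0 <= b ->
    (forall n x, C x -> `|h_ n x| <= b * w x) ->
    (forall x, C x -> h_ n x @[n --> \oo] --> h x) ->
    L (h_ n) @[n --> \oo] --> L h) ->
  (forall B, measurable B -> mu (B `&` C) = (L (ind B))%:E) ->
  forall h : X, (\int[mu]_(y in C) (h y)%:E = (L h)%:E)%E.
Proof.
move=> Llin Lcvg muL.
have pos : forall h : X, (forall x, C x -> 0 <= h x) ->
    (\int[mu]_(y in C) (h y)%:E = (L h)%:E)%E.
  apply: (wfun_ind mC (w_ge1 := w_ge1)
    (P := fun h : X => (\int[mu]_(y in C) (h y)%:E = (L h)%:E)%E)).
  - move=> B mB; rewrite -muL//.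
    under eq_integral => y /set_mem Cy do rewrite indE//.
    by rewrite integral_indic.
  - move=> c h1 h2 c0 h10 h20 e1 e2.
    have me (k : X) : measurable_fun C (EFin \o k).
      by apply/measurable_EFinP; exact: wfun_meas.
    have p1 x : C x -> (0 <= (h1 x)%:E)%E by move=> Cx; rewrite lee_fin h10.
    have p2 x : C x -> (0 <= (h2 x)%:E)%E by move=> Cx; rewrite lee_fin h20.
    under eq_integral do rewrite wfunD wfunZ EFinD EFinM.
    rewrite (ge0_integralD mu mC _ _ p2 (me h2)).
    + by rewrite (ge0_integralZl mu mC (me h1) p1) ?lee_fin// e1 e2 Llin EFinD EFinM.
    + by move=> x Cx; rewrite mule_ge0 ?p1.
    + exact: measurable_funeM (me h1).
  - move=> h_ h eh hb hmono hc.
    have c1 : (\int[mu]_(y in C) (h_ n y)%:E)%E @[n --> \oo] -->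
        (\int[mu]_(y in C) (h y)%:E)%E.
      have hl x : C x -> (h x)%:E = limn (fun n => (h_ n x)%:E).
        move=> Cx; apply/esym/cvg_lim => //.
        by apply: cvg_EFin; [exact: nearW|exact: hc].
      under [X in _ --> X]eq_integral => x /set_mem Cx do rewrite hl//.
      apply: (@cvg_monotone_convergence _ _ _ mu C mC (fun n x => (h_ n x)%:E)).
      + by move=> n; apply/measurable_EFinP; exact: wfun_meas.
      + by move=> n x Cx; rewrite lee_fin; have /andP[] := hb n x Cx.
      + by move=> x Cx m n mn; rewrite lee_fin hmono.
    have c2 : (L (h_ n))%:E @[n --> \oo] --> (L h)%:E.
      apply: cvg_EFin; first exact: nearW.
      apply: (Lcvg _ _ (wn h)) => //; first exact: wn_ge0.
      move=> n x Cx; have /andP[h0 hh] := hb n x Cx.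
      rewrite ger0_norm// (le_trans hh)// (le_trans (ler_norm _))//.
      exact: wn_bound.
    have e12 : (fun n => \int[mu]_(y in C) (h_ n y)%:E)%E = (fun n => (L (h_ n))%:E).
      by apply/funext => n; exact: eh.
    rewrite e12 in c1; exact: (cvg_unique _ c1 c2).
move=> h.
have Labs : Lw C w (fun x => `|h x|).
  have /(LwP w_ge1)[mh [k k0 hk]] := Lw_wfun w_ge1 h.
  apply/(LwP w_ge1); split; first exact: measurableT_comp.
  by exists k => // x Cx; rewrite normr_id; exact: hk.
(* h is the difference of the nonnegative functions |h| + h and |h|. *)
pose g : X := cut (fun x => `|h x|).
have gE x : C x -> g x = `|h x| by move=> Cx; rewrite /g cutE.
have g0 x : C x -> 0 <= g x by move=> Cx; rewrite gE.
have ig : mu.-integrable C (EFin \o g).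
  apply/integrableP; split; first by apply/measurable_EFinP; exact: wfun_meas.
  under eq_integral => x /set_mem Cx do rewrite /= ger0_norm ?g0//.
  by rewrite pos// ltry.
have igh : mu.-integrable C (EFin \o (g + h)).
  apply: (le_integrable mC _ _ (integrableD mC ig ig)).
    by apply/measurable_EFinP; exact: wfun_meas.
  move=> x Cx /=; rewrite lee_fin [leRHS]ger0_norm ?addr_ge0 ?g0//.
  by rewrite (le_trans (ler_normD _ _))// ger0_norm ?g0// lerD2l gE.
have hE : forall x, x \in C -> (h x)%:E = ((EFin \o (g + h)%R) x - (EFin \o g) x)%E.
  by move=> x _; rewrite /= -EFinB addrAC subrr add0r.
rewrite (eq_integral _ _ hE) integralB_EFin//.
rewrite (pos g)// (pos (g + h)); last first.
  by move=> x Cx; rewrite wfunD gE//; have := ler_norm (- h x); rewrite normrN; lra.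
have -> : g + h = 1 *: g + h by rewrite scale1r.
by rewrite Llin mul1r -EFinB addrC addrA [- _ + _]addrC subrr add0r.
Qed.

End Representation.
(** * From operators to kernels *)

Section Kernels.
Context {d : measure_display} {S : measurableType d} {R : realType}.
Variables (C : set S) (w : S -> R).
Hypotheses (mC : measurable C) (mw : measurable_fun C w).
Hypothesis w_ge1 : forall x, C x -> 1 <= w x.
Local Notation X := (wfun C w).
Local Notation A := (kop C w).
Local Notation ind := (ind w_ge1).
Local Notation cut := (cut w_ge1).
Implicit Types (Q : S -> set S -> R) (T : A).

Lemma Lw_mul_indic (P : set S) (h : X) : measurable P ->
  Lw C w (fun y => h y * \1_P y).
Proof.
move=> mP; have /(LwP w_ge1)[mh [k k0 hk]] := Lw_wfun w_ge1 h.
apply/(LwP w_ge1); split.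
  by apply: measurable_funM => //; exact: measurable_indic.
exists k => // y Cy; rewrite normrM (le_trans _ (hk y Cy))//.
by rewrite ler_piMr// ger0_norm// ?indicE ?lern1 ?leq_b1.
Qed.

Definition kernel_of_op T : S -> set S -> R := fun x B => T (ind B) x.

Lemma kernel_of_op_charge T x : C x -> exists m : {charge set S -> \bar R},
  forall B, (kernel_of_op T x B)%:E = m B.
Proof.
move=> Cx; pose m (B : set S) : \bar R := (T (ind B) x)%:E.
have m0 : m set0 = 0%E.
  rewrite /m; have -> : ind set0 = 0.
    by apply: wfunP => y Cy; rewrite indE// indic0.
  by rewrite kop0.
have mfin : fin_num_fun m by [].
have madd : semi_sigma_additive m.
  move=> F mF tF mUF; rewrite /m.
  have -> : (fun n => \sum_(0 <= i < n) (T (ind (F i)) x)%:E)%E =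
      EFin \o (fun n => T (\sum_(0 <= i < n) ind (F i)) x).
    by apply/funext => n /=; rewrite kop_sum wfun_sum sumEFin.
  apply: cvg_EFin; first exact: nearW.
  have sE n y : C y -> (\sum_(0 <= i < n) ind (F i)) y = \sum_(0 <= i < n) \1_(F i) y.
    by move=> Cy; rewrite wfun_sum; apply: eq_bigr => i _; rewrite indE.
  have eE (y : S) := @indic_bigcup _ R F y tF.
  have cs y : (\sum_(0 <= i < n) (\1_(F i) y : R)%:E)%E @[n --> \oo] -->
      (\1_(\bigcup_n F n) y : R)%:E.
    by rewrite eE; apply: is_cvg_nneseries => i _ _; rewrite lee_fin.
  apply: (@kop_cvg _ _ _ C w T (fun n => \sum_(0 <= i < n) ind (F i))
    (ind (\bigcup_n F n)) 1) => //.
  - move=> n y Cy; rewrite mul1r sE// (le_trans _ (w_ge1 Cy))//.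
    rewrite ger0_norm ?sumr_ge0// -lee_fin -sumEFin.
    apply: (@le_trans _ _ (\1_(\bigcup_n F n) y : R)%:E).
      rewrite eE; apply: nneseries_lim_ge => i _ _; rewrite lee_fin//.
    by rewrite lee_fin ?indicE ?lern1 ?leq_b1.
  - move=> y Cy; rewrite indE//; under eq_fun do rewrite sE//.
    have := cs y; under eq_fun do rewrite sumEFin.
    by move=> /fine_cvgP[_].
pose mc : {charge set S -> \bar R} := HB.pack m (isCharge.Build _ _ _ m m0 mfin madd).
by exists mc.
Qed.

(** With a Hahn decomposition P, N of T 1_B (x), the functionals
    h |-> T (h 1_P) (x) and h |-> - T (h 1_N) (x) represent the two variations,
    and their difference is h |-> T h (x). *)
Lemma eskact_kernel_of_op T h x : Lw C w h -> C x ->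
  eskact C (kernel_of_op T) h x = (T (cut h) x)%:E.
Proof.
move=> Lh Cx; have [m mE] := kernel_of_op_charge T Cx.
have [p [n [P [N [mP [mN [[PUN PIN] pE nE _ sE]]]]]]] :=
  signed_integral_jordan mC (fun B _ _ => mE B).
rewrite /eskact sE.
pose L (D : set S) (h : X) := T (cut (fun y => h y * \1_D y)) x.
have Llin D c h1 h2 : measurable D -> L D (c *: h1 + h2) = c * L D h1 + L D h2.
  move=> mD; rewrite /L -wfunZ -wfunD -kop_linear; congr (T _ x).
  apply: wfunP => y Cy; rewrite wfunD wfunZ !cutE//; try exact: Lw_mul_indic.
  by rewrite wfunD wfunZ mulrDl mulrA.
have Lcvg D : measurable D -> forall (h_ : nat -> X) (h : X) b, 0 <= b ->
    (forall n x, C x -> `|h_ n x| <= b * w x) ->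
    (forall x, C x -> h_ n x @[n --> \oo] --> h x) ->
    L D (h_ n) @[n --> \oo] --> L D h.
  move=> mD h_ h' b b0 hb hc; rewrite /L; apply: kop_cvg b0 _ _ _ Cx.
  - move=> k y Cy; rewrite cutE//; last exact: Lw_mul_indic.
    by rewrite normrM (le_trans _ (hb k y Cy))// ler_piMr// ger0_norm.
  - move=> y Cy; rewrite cutE//; last exact: Lw_mul_indic.
    under eq_fun do (rewrite cutE//; last exact: Lw_mul_indic).
    by apply: cvgM; [exact: hc|exact: cvg_cst].
have Lind D B : measurable D -> measurable B ->
    L D (ind B) = kernel_of_op T x (B `&` C `&` C `&` D).
  move=> mD mB; rewrite /L /kernel_of_op; congr (T _ x).
  apply: wfunP => y Cy; rewrite cutE//; last exact: Lw_mul_indic.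
  rewrite !indE//; last by do 3! apply: measurableI => //.
  by rewrite !indicI /= -[\1_C y]/((y \in C)%:R) mem_set// !mulr1.
have hE (mu : {measure set S -> \bar R}) :
    (\int[mu]_(y in C) (h y)%:E = \int[mu]_(y in C) (cut h y)%:E)%E.
  by apply: eq_integral => y /set_mem Cy; rewrite cutE.
rewrite !hE (daniell mC (w_ge1 := w_ge1) (L := L P)); first last.
- by move=> B mB; rewrite pE ?Lind//; exact: measurableI.
- exact: Lcvg.
- by move=> *; exact: Llin.
rewrite (daniell mC (w_ge1 := w_ge1) (L := fun h => - L N h)); first last.
- by move=> B mB; rewrite nE ?Lind//; exact: measurableI.
- by move=> h_ h' b b0 hb hc; apply: cvgN; exact: Lcvg hb hc.
- by move=> c h1 h2; rewrite Llin// opprD mulrN.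
rewrite EFinN oppeK -EFinD; congr EFin.
rewrite /L -wfunD -kopD; congr (T _ x).
apply: wfunP => y Cy; rewrite wfunD !cutE//; try exact: Lw_mul_indic.
rewrite -mulrDr; have : [set: S] y by []; rewrite -PUN => yPN.
suff -> : \1_P y + \1_N y = 1 :> R by rewrite mulr1.
rewrite !indicE; have [yP|yP] := boolP (y \in P).
  rewrite memNset ?addr0// => yN.
  by move: PIN; apply/eqP/set0P; exists y; split => //; exact: set_mem.
rewrite mem_set ?add0r//; case: yPN => // /mem_set yP1.
by rewrite yP1 in yP.
Qed.

(** Kernels matter only through their values at points and measurable subsets
    of C. *)
Definition eq_kernel Q Q' : Prop :=
  forall x B, C x -> measurable B -> B `<=` C -> Q x B = Q' x B.

Lemma eq_eskact Q Q' h x : eq_kernel Q Q' -> C x ->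
  eskact C Q h x = eskact C Q' h x.
Proof.
move=> QQ' Cx; rewrite /eskact /signed_integral.
have uvE (nu nu' : set S -> R) :
    (forall B, measurable B -> B `<=` C -> nu B = nu' B) ->
    upper_variation C nu = upper_variation C nu'.
  move=> nunu; apply/funext => B; rewrite /upper_variation; congr ereal_sup.
  apply: eq_imagel => B' [mB' B'C]; rewrite nunu//.
  by apply: subset_trans B'C _; exact: subIsetr.
congr (_ - _)%E.
  by rewrite (uvE _ (Q' x))// => B mB BC; exact: QQ'.
by rewrite (uvE _ (- Q' x))// => B mB BC; congr (- _); exact: QQ'.
Qed.

Lemma eq_sknorm Q Q' : eq_kernel Q Q' -> sknorm C w Q = sknorm C w Q'.
Proof.
move=> QQ'; have eE h : ewnorm C w (eskact C Q h) = ewnorm C w (eskact C Q' h).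
  rewrite /ewnorm; congr (Defs.sup0 _); apply: eq_imagel => x Cx /=.
  by rewrite (eq_eskact _ QQ').
have fE : (fun h => (ewnorm C w (eskact C Q h) / wnorm C w h)%E) =
    (fun h => (ewnorm C w (eskact C Q' h) / wnorm C w h)%E).
  by apply/funext => h; rewrite eE.
exact: (congr1 (fun F : (S -> R) -> \bar R => Defs.sup0
  (F @` [set h | Lw C w h /\ wnorm C w h != 0%E])) fE).
Qed.

Lemma eq_LLw Q Q' : eq_kernel Q Q' -> LLw C w Q -> LLw C w Q'.
Proof.
move=> QQ' [[Qm Qx] nQ]; split; last by rewrite -(eq_sknorm QQ').
split=> [x Cx|B mB BC].
  have [m mE] := Qm _ Cx; exists m => B mB BC.
  by rewrite -(QQ' x B)//; exact: mE.
by apply: eq_measurable_fun (Qx _ mB BC) => x /set_mem Cx; exact: QQ'.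
Qed.

Lemma sknorm_ge0 Q : (0 <= sknorm C w Q)%E. Proof. exact: sup0_ge0. Qed.

Lemma sknorm_le Q k : 0 <= k ->
  (forall h, Lw C w h -> forall x, C x ->
    (`|eskact C Q h x| <= (k * fine (wnorm C w h) * w x)%:E)%E) ->
  (sknorm C w Q <= k%:E)%E.
Proof.
move=> k0 Qk; apply: sup0_le; first by rewrite lee_fin.
move=> _ [h [Lh h0] <-].
have hfin := LwE Lh; set r := fine _ in hfin.
have r0 : 0 < r.
  by rewrite -lte_fin -hfin lt_neqAle eq_sym h0 wnorm_ge0.
rewrite hfin inver gt_eqF// lee_pdivrMr//.
apply/(ewnorm_leP w_ge1) => [|x Cx]; first by rewrite mulr_ge0// ltW.
exact: Qk.
Qed.

Lemma LLw_kernel_of_op T : LLw C w (kernel_of_op T).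
Proof.
split.
  split=> [x Cx|B mB BC]; last exact: wfun_meas.
  have [m mE] := kernel_of_op_charge T Cx; exists m => B _ _; exact: mE.
have [k k0 Tk] := kop_bound T.
apply: (@le_lt_trans _ _ k%:E); last exact: ltry.
apply: sknorm_le => // h Lh x Cx; rewrite eskact_kernel_of_op// lee_fin.
apply: Tk => //; first by rewrite fine_ge0// wnorm_ge0.
move=> y Cy; rewrite cutE//; have := LwE Lh.
move=> hE; move: y Cy; apply/(wnorm_leP w_ge1); last by rewrite -hE.
by rewrite fine_ge0// wnorm_ge0.
Qed.

Lemma LLw_bound Q h x : LLw C w Q -> Lw C w h -> wnorm C w h != 0%E -> C x ->
  (`|eskact C Q h x| <= (fine (sknorm C w Q) * fine (wnorm C w h) * w x)%:E)%E.
Proof.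
move=> [_ Qfin] Lh h0 Cx.
have hfin := LwE Lh; set r := fine (wnorm _ _ _) in hfin *.
have r0 : 0 < r.
  by rewrite -lte_fin -hfin lt_neqAle eq_sym h0 wnorm_ge0.
move: x Cx; apply/(ewnorm_leP w_ge1).
  by rewrite mulr_ge0 ?(ltW r0)// fine_ge0// sknorm_ge0.
have : (ewnorm C w (eskact C Q h) / wnorm C w h <= sknorm C w Q)%E.
  by apply: sup0_ge; exists h.
rewrite hfin inver gt_eqF// lee_pdivrMr// => le1.
by rewrite EFinM fineK// ge0_fin_numE// sknorm_ge0.
Qed.

Lemma integral_wfun (mu : {measure set S -> \bar R}) :
  mu.-integrable C (EFin \o w) ->
  [/\ forall h : X, mu.-integrable C (EFin \o h),
    forall c (h1 h2 : X), fine (\int[mu]_(y in C) ((c *: h1 + h2) y)%:E) =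
      c * fine (\int[mu]_(y in C) (h1 y)%:E) + fine (\int[mu]_(y in C) (h2 y)%:E) &
    forall (h_ : nat -> X) (h : X) b, 0 <= b ->
      (forall n x, C x -> `|h_ n x| <= b * w x) ->
      (forall x, C x -> h_ n x @[n --> \oo] --> h x) ->
      fine (\int[mu]_(y in C) (h_ n y)%:E) @[n --> \oo] -->
      fine (\int[mu]_(y in C) (h y)%:E)].
Proof.
move=> iw.
have me (h : X) : measurable_fun C (EFin \o h).
  by apply/measurable_EFinP; exact: wfun_meas.
have ibw b : mu.-integrable C (fun y => (b * w y)%:E).
  by apply: eq_integrable (integrableZl mC b iw) => // y _; rewrite /= EFinM.
have ih (h : X) : mu.-integrable C (EFin \o h).
  apply: (le_integrable mC (me h) _ (ibw (wn h))) => y Cy.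
  by rewrite /= lee_fin (le_trans (wn_bound w_ge1 h Cy))// ler_norm.
have fint (h : X) : (\int[mu]_(y in C) (h y)%:E \is a fin_num)%E.
  exact: (integral_fune_fin_num mC (ih h)).
split => //.
- move=> c h1 h2; rewrite -[RHS]/(fine _%:E) EFinD EFinM !fineK//.
  congr fine; under eq_integral do rewrite wfunD wfunZ EFinD EFinM.
  rewrite integralD//; [by rewrite integralZl//; exact: ih| |exact: ih].
  exact: (integrableZl mC c (ih h1)).
- move=> h_ h b b0 hb hc.
  have ch : {ae mu, forall y, C y -> (h_ n y)%:E @[n --> \oo] --> (h y)%:E}.
    by apply: aeW => y Cy; apply: cvg_EFin; [exact: nearW|exact: hc].
  have bh : {ae mu, forall y n, C y -> (`|(h_ n y)%:E| <= (b * w y)%:E)%E}.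
    by apply: aeW => y n Cy; rewrite lee_fin; exact: hb.
  have [_ _] := dominated_convergence mC (fun n => me (h_ n)) (me h) ch (ibw b) bh.
  by rewrite -(fineK (fint h)) => /fine_cvgP[_].
Qed.

End Kernels.
(** * From kernels to operators *)

Section Operators.
Context {d : measure_display} {S : measurableType d} {R : realType}.
Variables (C : set S) (w : S -> R).
Hypotheses (mC : measurable C) (mw : measurable_fun C w).
Hypothesis w_ge1 : forall x, C x -> 1 <= w x.
Local Notation X := (wfun C w).
Local Notation A := (kop C w).
Local Notation ind := (ind w_ge1).
Local Notation cut := (cut w_ge1).
Local Notation kernel := (kernel_of_op w_ge1).
Implicit Types (Q : S -> set S -> R) (T : A).

Lemma Lw_weight : Lw C w w.
Proof.
apply/(LwP w_ge1); split => //; exists 1 => // x Cx.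
by rewrite mul1r ger0_norm// ltW// (w_gt0 w_ge1).
Qed.

Lemma sknorm_ext Q : LLw C w Q -> sknorm C w Q = (fine (sknorm C w Q))%:E.
Proof. by move=> [_ h]; rewrite fineK// ge0_fin_numE// sknorm_ge0. Qed.

(** Finiteness of the operator norm bounds both variations of Q x, because the
    difference of the two integrals of w is finite only if both are. *)
Lemma LLw_jordan Q x : LLw C w Q -> C x ->
  exists p n : {measure set S -> \bar R},
    [/\ p.-integrable C (EFin \o w), n.-integrable C (EFin \o w),
      forall B, measurable B -> B `<=` C -> (Q x B)%:E = (p B - n B)%E &
      forall h, eskact C Q h x =
        (\int[p]_(y in C) (h y)%:E - \int[n]_(y in C) (h y)%:E)%E].
Proof.
move=> LQ Cx; have [[Qm _] _] := LQ; have [m mE] := Qm _ Cx.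
have [p [n [P [N [_ [_ [_ _ _ pnE sE]]]]]]] := signed_integral_jordan mC mE.
exists p, n.
have w0 : wnorm C w w != 0%E.
  apply/eqP => w0; have := w_gt0 w_ge1 Cx; rewrite ltNge => /negP; apply.
  have /(wnorm_leP w_ge1)-/(_ (lexx 0) x Cx) : (wnorm C w w <= 0%:E)%E by rewrite w0.
  by rewrite mul0r; apply: le_trans; exact: ler_norm.
have := LLw_bound w_ge1 LQ Lw_weight w0 Cx; rewrite /eskact sE.
have iw (mu : {measure set S -> \bar R}) :
    (\int[mu]_(y in C) (w y)%:E < +oo)%E -> mu.-integrable C (EFin \o w).
  move=> fw; apply/integrableP; split; first exact/measurable_EFinP.
  under eq_integral => y /set_mem Cy do rewrite /= ger0_norm ?(ltW (w_gt0 w_ge1 Cy))//.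
  exact: fw.
have p0 (mu : {measure set S -> \bar R}) : (0 <= \int[mu]_(y in C) (w y)%:E)%E.
  by apply: integral_ge0 => y Cy; rewrite lee_fin ltW// (w_gt0 w_ge1).
move: (p0 p) (p0 n) (iw p) (iw n).
case: (\int[p]_(y in C) (w y)%:E)%E => [a||] //;
  case: (\int[n]_(y in C) (w y)%:E)%E => [b||] // _ _ ip inn _.
by split => //; [apply: ip|apply: inn]; rewrite ltry.
Qed.

Lemma skact_functional Q x : LLw C w Q -> C x ->
  [/\ forall h : X, eskact C Q h x = (skact C Q h x)%:E,
    forall c (h1 h2 : X), skact C Q (c *: h1 + h2 : X) x =
      c * skact C Q h1 x + skact C Q h2 x,
    forall (h_ : nat -> X) (h : X) b, 0 <= b ->
      (forall n x, C x -> `|h_ n x| <= b * w x) ->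
      (forall x, C x -> h_ n x @[n --> \oo] --> h x) ->
      skact C Q (h_ n) x @[n --> \oo] --> skact C Q h x &
    forall B, measurable B -> skact C Q (ind B) x = Q x (B `&` C)].
Proof.
move=> LQ Cx; have [p [n [ip inn QE sE]]] := LLw_jordan LQ Cx.
have [p1 p2 p3] := integral_wfun mC w_ge1 ip.
have [n1 n2 n3] := integral_wfun mC w_ge1 inn.
have fp (h : X) := integral_fune_fin_num mC (p1 h).
have fn (h : X) := integral_fune_fin_num mC (n1 h).
have skE (h : X) : skact C Q h x =
    fine (\int[p]_(y in C) (h y)%:E) - fine (\int[n]_(y in C) (h y)%:E).
  by rewrite /skact sE fineB//; [exact: fp|exact: fn].
split.
- by move=> h; rewrite skE sE EFinB !fineK//; [exact: fn|exact: fp].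
- by move=> c h1 h2; rewrite !skE p2 n2; ring.
- move=> h_ h b b0 hb hc; rewrite skE; under eq_fun do rewrite skE.
  by apply: cvgB; [exact: p3 hb hc|exact: n3 hb hc].
- move=> B mB; rewrite skE.
  have indI (mu : {measure set S -> \bar R}) :
      (\int[mu]_(y in C) (ind B y)%:E = mu (B `&` C))%E.
    under eq_integral => y /set_mem Cy do rewrite indE//.
    by rewrite integral_indic.
  apply: EFin_inj; rewrite QE; [|exact: measurableI|exact: subIsetr].
  by rewrite EFinB !fineK ?indI//; [have := fn (ind B)|have := fp (ind B)]; rewrite indI.
Qed.

Lemma eq_skact Q (h1 h2 : S -> R) x : (forall y, C y -> h1 y = h2 y) ->
  eskact C Q h1 x = eskact C Q h2 x.
Proof.
move=> h12; rewrite /eskact /signed_integral /integral.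
have /eq_restrictP -> // : {in C, EFin \o h1 =1 EFin \o h2}.
by move=> y /set_mem Cy /=; rewrite h12.
Qed.

Lemma wnorm_eq0 (h : S -> R) : Lw C w h -> wnorm C w h = 0%E ->
  forall x, C x -> h x = 0.
Proof.
move=> Lh h0 x Cx; apply/eqP; rewrite -normr_le0 -(mul0r (w x)).
by move: x Cx; apply/(wnorm_leP w_ge1) => //; rewrite h0.
Qed.

Lemma skact_bound Q (h : X) x : LLw C w Q -> C x ->
  `|skact C Q h x| <= fine (sknorm C w Q) * wn h * w x.
Proof.
move=> LQ Cx; have [e1 e2 _ _] := skact_functional LQ Cx.
have Lh := Lw_wfun w_ge1 h.
have [h0|h0] := eqVneq (wnorm C w h) 0%E.
  have -> : h = 0 *: h + 0 :> X.
    apply: wfunP => y Cy; rewrite wfunD wfunZ mul0r addr0.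
    exact: wnorm_eq0 Lh h0 _ Cy.
  have z0 : skact C Q (0 : X) x = 0.
    have /= := e2 (-1) 0 0; rewrite scaler0 addr0 mulN1r addNr; exact.
  rewrite e2 mul0r z0 add0r normr0.
  by rewrite !mulr_ge0// ?wn_ge0 ?(ltW (w_gt0 w_ge1 Cx))// fine_ge0// sknorm_ge0.
by have := LLw_bound w_ge1 LQ Lh h0 Cx; rewrite e1 lee_fin.
Qed.

(** The dependence on x is measurable for indicators, because Q is a kernel, and
    this is preserved by combinations and by pointwise limits. *)
Lemma measurable_skact Q (h : X) : LLw C w Q -> measurable_fun C (skact C Q h).
Proof.
move=> LQ; have [[_ mQ] _] := LQ.
have e2 c (h1 h2 : X) x : C x -> skact C Q (c *: h1 + h2 : X) x =
    c * skact C Q h1 x + skact C Q h2 x.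
  by move=> Cx; have [_ e2 _ _] := skact_functional LQ Cx; exact: e2.
have comb c (h1 h2 : X) : measurable_fun C (skact C Q h1) ->
    measurable_fun C (skact C Q h2) ->
    measurable_fun C (skact C Q (c *: h1 + h2 : X)).
  move=> m1 m2.
  apply: (@eq_measurable_fun _ _ _ _ C
    (fun x => c * skact C Q h1 x + skact C Q h2 x)).
    by move=> x /set_mem Cx; rewrite e2.
  apply: measurable_funD => //; apply: measurable_funM => //.
have pos : forall h : X, (forall x, C x -> 0 <= h x) ->
    measurable_fun C (skact C Q h).
  apply: (wfun_ind mC (w_ge1 := w_ge1)
    (P := fun h : X => measurable_fun C (skact C Q h))).
  - move=> B mB.
    apply: (@eq_measurable_fun _ _ _ _ C (fun x => Q x (B `&` C))).
      move=> x /set_mem Cx; have [_ _ _ e4] := skact_functional LQ Cx.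
      by rewrite e4.
    by apply: mQ; [exact: measurableI|exact: subIsetr].
  - by move=> c h1 h2 _ _ _; exact: comb.
  - move=> h_ h0 mh hb _ hc; apply: (measurable_fun_cvg mh) => x Cx.
    have [_ _ e3 _] := skact_functional LQ Cx.
    apply: (e3 _ _ (wn h0)) => //; first exact: wn_ge0.
    move=> n y Cy; have /andP[h0' hh] := hb n y Cy.
    by rewrite ger0_norm// (le_trans hh)// (le_trans (ler_norm _))// (wn_bound w_ge1).
pose g : X := cut (fun x => `|h x|).
have Lg : Lw C w (fun x => `|h x|).
  apply/(LwP w_ge1); split; first by apply: measurableT_comp => //; exact: wfun_meas.
  by exists (wn h); [exact: wn_ge0|move=> x Cx; rewrite normr_id (wn_bound w_ge1)].
have -> : h = (-1) *: g + (g + h) :> X.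
  by rewrite scaleN1r addrA addNr add0r.
apply: comb; apply: pos => x Cx; rewrite ?wfunD /g cutE//.
by have := ler_norm (- h x); rewrite normrN; lra.
Qed.

Lemma Lw_skact Q (h : X) : LLw C w Q -> Lw C w (skact C Q h).
Proof.
move=> LQ; apply/(LwP w_ge1); split; first exact: measurable_skact.
exists (fine (sknorm C w Q) * wn h).
  by rewrite mulr_ge0 ?wn_ge0// fine_ge0// sknorm_ge0.
by move=> x Cx; exact: skact_bound.
Qed.

Lemma op_of_kernel_subproof Q : LLw C w Q ->
  (fun h : X => cut (skact C Q h)) \in @kop_pred _ _ _ C w.
Proof.
move=> LQ; apply/asboolP; split.
- move=> c h1 h2; apply: wfunP => x Cx; rewrite wfunD wfunZ !cutE//; try exact: Lw_skact.
  by have [_ e2 _ _] := skact_functional LQ Cx; exact: e2.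
- exists (fine (sknorm C w Q)); first by rewrite fine_ge0// sknorm_ge0.
  move=> h b b0 hb x Cx; rewrite cutE//; last exact: Lw_skact.
  rewrite (le_trans (skact_bound _ LQ Cx))// ler_wpM2r ?(ltW (w_gt0 w_ge1 Cx))//.
  by rewrite ler_wpM2l ?fine_ge0 ?sknorm_ge0//; exact/(wn_leP w_ge1).
- move=> h_ h b b0 hb hc x Cx; rewrite cutE//; last exact: Lw_skact.
  under eq_fun do (rewrite cutE//; last exact: Lw_skact).
  by have [_ _ e3 _] := skact_functional LQ Cx; exact: e3 b0 hb hc.
Qed.

Definition op_of_kernel Q : A :=
  if pselect (LLw C w Q) is left LQ then KOp (op_of_kernel_subproof LQ) else 0.

Lemma op_of_kernelE Q (h : X) x : LLw C w Q -> C x ->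
  op_of_kernel Q h x = skact C Q h x.
Proof.
move=> LQ Cx; rewrite /op_of_kernel; case: pselect => //= LQ'.
by rewrite cutE//; exact: Lw_skact.
Qed.

Lemma skactE Q h x : LLw C w Q -> Lw C w h -> C x ->
  skact C Q h x = op_of_kernel Q (cut h) x.
Proof.
move=> LQ Lh Cx; rewrite op_of_kernelE// /skact; congr fine.
by apply: eq_skact => y Cy; rewrite cutE.
Qed.

Lemma eskactE Q h x : LLw C w Q -> Lw C w h -> C x ->
  eskact C Q h x = (op_of_kernel Q (cut h) x)%:E.
Proof.
move=> LQ Lh Cx; rewrite op_of_kernelE//.
have [e1 _ _ _] := skact_functional LQ Cx; rewrite -e1.
by apply: eq_skact => y Cy; rewrite cutE.
Qed.

Lemma op_of_kernelK Q : LLw C w Q -> eq_kernel C Q (kernel (op_of_kernel Q)).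
Proof.
move=> LQ x B Cx mB BC; rewrite /kernel_of_op op_of_kernelE//.
have [_ _ _ e4] := skact_functional LQ Cx.
by rewrite e4// (setIidl BC).
Qed.

(** Recognizing a kernel from an operator that has the same values: the way in
    which sums, products and identities of kernels are computed below. *)
Lemma op_of_kernel_eq Q T : eq_kernel C Q (kernel T) ->
  LLw C w Q /\ op_of_kernel Q = T.
Proof.
move=> QT; have LQ : LLw C w Q.
  apply: (@eq_LLw _ _ _ _ _ (kernel T)); last exact: LLw_kernel_of_op.
  by move=> x B Cx mB BC; rewrite QT.
split => //; apply: kopP => h x Cx; rewrite op_of_kernelE// /skact.
rewrite (eq_eskact _ QT)// eskact_kernel_of_op//; last exact: Lw_wfun.
by rewrite cutK.
Qed.

Definition opn T : R := fine (sknorm C w (kernel T)).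

Lemma opn_ge0 T : 0 <= opn T.
Proof. by rewrite fine_ge0// sknorm_ge0. Qed.

Lemma opn_leP T k : 0 <= k -> opn T <= k <-> forall h : X, wn (T h) <= k * wn h.
Proof.
move=> k0; have LT := LLw_kernel_of_op mC w_ge1 T.
split=> [Tk h|Tk].
  apply/(wn_leP w_ge1) => [|x Cx]; first by rewrite mulr_ge0// wn_ge0.
  have /op_of_kernel_eq[_ TE] : eq_kernel C (kernel T) (kernel T) by [].
  rewrite -TE op_of_kernelE// (le_trans (skact_bound _ LT Cx))//.
  by rewrite ler_wpM2r ?(ltW (w_gt0 w_ge1 Cx))// ler_wpM2r// wn_ge0.
rewrite -lee_fin /opn -sknorm_ext//; apply: sknorm_le => // h Lh x Cx.
rewrite eskact_kernel_of_op// lee_fin.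
have -> : fine (wnorm C w h) = wn (cut h).
  by rewrite /wn; congr fine; apply: eq_wnorm => y Cy; rewrite cutE.
rewrite (le_trans (wn_bound w_ge1 _ Cx))//.
by rewrite ler_wpM2r ?(ltW (w_gt0 w_ge1 Cx)).
Qed.

Lemma opn_bound T h : wn (T h) <= opn T * wn h.
Proof. by move: h; apply/opn_leP => //; exact: opn_ge0. Qed.

Lemma seminorm_opn : seminorm opn.
Proof.
apply: seminormW; first exact: opn_ge0.
- move=> T1 T2; apply/opn_leP; first by rewrite addr_ge0 ?opn_ge0.
  move=> h; rewrite kopDE (le_trans (seminormD (seminorm_wn w_ge1) _ _))// mulrDl.
  by rewrite lerD// opn_bound.
- move=> c T; apply/opn_leP; first by rewrite mulr_ge0 ?opn_ge0.
  by move=> h; rewrite kopZE (seminormZ (seminorm_wn w_ge1)) -mulrA ler_wpM2l// opn_bound.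
Qed.

Lemma isolift_LLw : isolift (LLw C w) (sknorm C w) opn op_of_kernel kernel.
Proof.
split.
- move=> c Q1 Q2 L1 L2; apply: op_of_kernel_eq => x B Cx mB BC.
  rewrite /kernel_of_op kopDE kopZE wfunD wfunZ.
  by rewrite -[LHS]/(c * Q1 x B + Q2 x B) (op_of_kernelK L1)// (op_of_kernelK L2).
- move=> Q LQ; rewrite /opn -(eq_sknorm w (op_of_kernelK LQ)).
  exact: sknorm_ext.
- by move=> T; have [] := @op_of_kernel_eq (kernel T) T (fun _ _ _ _ _ => erefl).
Qed.

Lemma op_of_skcomp Q1 Q2 : LLw C w Q1 -> LLw C w Q2 ->
  LLw C w (skcomp C Q1 Q2) /\
  op_of_kernel (skcomp C Q1 Q2) = kop_comp (op_of_kernel Q1) (op_of_kernel Q2).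
Proof.
move=> L1 L2; apply: op_of_kernel_eq => x B Cx mB BC; rewrite /skcomp.
have E2 y : C y -> Q2 y B = op_of_kernel Q2 (ind B) y.
  by move=> Cy; rewrite (op_of_kernelK L2).
rewrite /kernel_of_op /= op_of_kernelE//; rewrite /skact; congr fine.
exact: eq_skact.
Qed.

Lemma op_of_skid : LLw C w skid /\ op_of_kernel skid = kop_id C w.
Proof.
by apply: op_of_kernel_eq => x B Cx mB BC; rewrite /kernel_of_op /= indE.
Qed.

End Operators.
(** * Neumann series *)

Section GeometricDecay.
Context {R : realType}.

Lemma bernoulli_le (x : R) m : 0 <= x <= 1 -> 1 - m%:R * x <= (1 - x) ^+ m.
Proof.
move=> /andP[x0 x1]; elim: m => [|m ih]; first by rewrite mul0r subr0 expr0.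
rewrite exprSr; apply: (@le_trans _ _ ((1 - m%:R * x) * (1 - x))).
  have : 0 <= m%:R * x * x by rewrite !mulr_ge0.
  by rewrite -natr1; lra.
by rewrite ler_wpM2r// subr_ge0.
Qed.

(** If the m-th power of a bounded operator is a strict contraction, then its
    powers decay geometrically, at a rate depending only on the two bounds. The
    rate r is chosen so that q <= r ^+ m without extracting a root. *)
Lemma geometric_decay (q B : R) m : (0 < m)%N -> 0 <= q < 1 -> 0 <= B ->
  exists D r : R, [/\ 0 <= D, 0 < r < 1 &
    forall a : nat -> R, (forall n, 0 <= a n) -> a 0%N <= 1 ->
      (forall n, a n.+1 <= B * a n) -> (forall n, a (n + m)%N <= q * a n) ->
      forall n, a n <= D * r ^+ n].
Proof.
move=> m0 /andP[q0 q1] B0.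
pose x := (1 - q) / 2 / m%:R.
have mr : (1 : R) <= m%:R by rewrite ler1n.
have m0r : (0 : R) < m%:R by apply: lt_le_trans mr.
have x0 : 0 < x by rewrite /x !divr_gt0// subr_gt0.
have x2 : x <= 2^-1.
  rewrite /x ler_pdivrMr// (@le_trans _ _ 2^-1)//; first by lra.
  by rewrite ler_peMr.
pose r := 1 - x; have r0 : 0 < r by rewrite /r; lra.
have r1 : r < 1 by rewrite /r; lra.
have qr : q <= r ^+ m.
  apply: (@le_trans _ _ (1 - m%:R * x)).
    by rewrite /x mulrC divfK ?gt_eqF//; lra.
  by apply: bernoulli_le; apply/andP; split; lra.
have D0 : 0 <= ((1 + B) / r) ^+ m.
  by apply: exprn_ge0; apply: divr_ge0; [exact: addr_ge0|exact: ltW].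
exists (((1 + B) / r) ^+ m), r; split => //; first by rewrite r0.
move=> a a0 a1 aB aq n; elim/ltn_ind: n => n ih.
have [nm|mn] := ltnP n m; last first.
  rewrite -(subnK mn) (le_trans (aq _))// exprD mulrA mulrC.
  rewrite ler_pM//; apply: ih; rewrite ltn_subrL m0/=; exact: leq_trans m0 mn.
have aBn : a n <= B ^+ n.
  elim: n {ih nm} => [|n ih]; first by rewrite expr0.
  by rewrite exprS (le_trans (aB _))// ler_wpM2l.
apply: (le_trans aBn); rewrite expr_div_n -mulrA [_^-1 * _]mulrC.
apply: (@le_trans _ _ ((1 + B) ^+ m)).
  apply: (@le_trans _ _ ((1 + B) ^+ n)).
    by rewrite lerXn2r ?nnegrE ?addr_ge0// lerDr.
  by rewrite ler_weXn2l ?lerDl// ltnW.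
rewrite ler_peMr ?exprn_ge0 ?addr_ge0//.
rewrite ler_pdivlMr ?exprn_gt0// mul1r.
by apply: ler_wiXn2l; [exact: ltW|exact: ltW|exact: ltnW].
Qed.

Lemma geometric_tail (r : R) N M : 0 < r < 1 -> (N <= M)%N ->
  \sum_(N <= i < M) r ^+ i <= r ^+ N / (1 - r).
Proof.
move=> /andP[r0 r1] NM; rewrite ler_pdivlMr ?subr_gt0//.
have -> : (\sum_(N <= i < M) r ^+ i) * (1 - r) = r ^+ N - r ^+ M.
  elim: M NM => [|M ih].
    by rewrite leqn0 => /eqP ->; rewrite big_geq// mul0r subrr.
  rewrite leq_eqVlt => /predU1P[<-|]; first by rewrite big_geq// mul0r subrr.
  rewrite ltnS => NM; rewrite big_nat_recr//= mulrDl ih// exprS.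
  by ring.
by rewrite lerBlDr lerDl exprn_ge0// ltW.
Qed.

End GeometricDecay.

Section Neumann.
Context {d : measure_display} {S : measurableType d} {R : realType}.
Variables (C : set S) (w : S -> R).
Hypotheses (mC : measurable C) (mw : measurable_fun C w).
Hypothesis w_ge1 : forall x, C x -> 1 <= w x.
Local Notation X := (wfun C w).
Local Notation A := (kop C w).
Local Notation cut := (cut w_ge1).
Local Notation opn := (opn w_ge1).
Implicit Types (T K : A).

Lemma kop_compBl T1 T2 T : kop_comp (T1 - T2) T = kop_comp T1 T - kop_comp T2 T.
Proof. exact: kopP. Qed.

Lemma kop_compZl c T1 T : kop_comp (c *: T1) T = c *: kop_comp T1 T.
Proof. exact: kopP. Qed.

Lemma kop_compBr T T1 T2 : kop_comp T (T1 - T2) = kop_comp T T1 - kop_comp T T2.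
Proof.
by apply: kopP => h x Cx; rewrite -[LHS]/(T (T1 h - T2 h) x) kopB.
Qed.

Lemma kop_compZr c T T1 : kop_comp T (c *: T1) = c *: kop_comp T T1.
Proof. by apply: kopP => h x Cx; rewrite -[LHS]/(T (c *: T1 h) x) kopZ. Qed.

Lemma opn_comp T1 T2 : opn (kop_comp T1 T2) <= opn T1 * opn T2.
Proof.
apply/(opn_leP mC mw w_ge1); first by rewrite mulr_ge0 ?opn_ge0.
move=> h; rewrite /= -mulrA (le_trans (opn_bound mC mw w_ge1 _ _))//.
by rewrite ler_wpM2l ?opn_ge0// opn_bound.
Qed.

Definition kop_pow T n : A := iter n (kop_comp T) (kop_id C w).

Lemma kop_powSr T n h : kop_pow T n.+1 h = kop_pow T n (T h).
Proof. by elim: n => [//|n ih]; rewrite -[LHS]/(T (kop_pow T n.+1 h)) ih. Qed.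

Lemma kop_powD T n m h : kop_pow T (n + m) h = kop_pow T n (kop_pow T m h).
Proof. by elim: n => [//|n ih]; rewrite -[LHS]/(T (kop_pow T (n + m) h)) ih. Qed.

Lemma cts_kop_pow (F : R -> A) t n : cts_at opn F t ->
  cts_at opn (fun s => kop_pow (F s) n) t.
Proof.
have sn := seminorm_opn mC mw w_ge1.
move=> cF; elim: n => [|n ih]; first exact: cts_cst.
exact: (cts_act sn sn kop_compBl kop_compBr opn_comp).
Qed.

Section Series.
Variables (K : A) (D r : R).
Hypotheses (D0 : 0 <= D) (r01 : 0 < r < 1).
Hypothesis decay : forall n h, wn (kop_pow K n h) <= D * r ^+ n * wn h.

Let partial n (h : X) : X := \sum_(0 <= i < n) kop_pow K i h.

Let partialE n h x : partial n h x = \sum_(0 <= i < n) kop_pow K i h x.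
Proof. by rewrite /partial wfun_sum. Qed.

Let r0 : 0 <= r. Proof. by case/andP: r01 => /ltW. Qed.
Let r1 : `|r| < 1. Proof. by rewrite ger0_norm//; case/andP: r01. Qed.
Let r1' : 0 < 1 - r. Proof. by rewrite subr_gt0; case/andP: r01. Qed.

Let tail_cst N (h : X) := D * r ^+ N / (1 - r) * wn h.

Let partial_tail N M h x : C x -> (N <= M)%N ->
  `|partial M h x - partial N h x| <= tail_cst N h * w x.
Proof.
move=> Cx NM; rewrite !partialE (big_cat_nat (leq0n N) NM)/=.
rewrite [X in X - _]addrC addrK.
apply: (@le_trans _ _ (\sum_(N <= i < M) D * wn h * w x * r ^+ i)).
  apply: (le_trans (ler_norm_sum _ _ _)); apply: ler_sum => i _.
  rewrite (le_trans (wn_bound w_ge1 _ Cx))// [leRHS]mulrAC.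
  by rewrite ler_wpM2r ?(ltW (w_gt0 w_ge1 Cx))// [leRHS]mulrAC decay.
rewrite -mulr_sumr.
have -> : tail_cst N h * w x = D * wn h * w x * (r ^+ N / (1 - r)).
  by rewrite /tail_cst; ring.
apply: ler_wpM2l; last exact: geometric_tail.
by rewrite !mulr_ge0 ?wn_ge0// ltW// (w_gt0 w_ge1).
Qed.

Let partial_cvg h x : C x -> cvgn (fun n => partial n h x).
Proof.
move=> Cx.
have -> : (fun n => partial n h x) = series (fun i => kop_pow K i h x).
  by apply/funext => n; rewrite partialE.
apply: normed_cvg.
apply: (@series_le_cvg _ _ (geometric (D * wn h * w x) r)) => //.
- by move=> n /=.
- by move=> n; rewrite /geometric/= !mulr_ge0 ?wn_ge0 ?exprn_ge0// ltW// (w_gt0 w_ge1).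
- move=> n /=; rewrite (le_trans (wn_bound w_ge1 _ Cx))// /geometric/=.
  rewrite [leRHS]mulrAC ler_wpM2r ?(ltW (w_gt0 w_ge1 Cx))//.
  by rewrite [leRHS]mulrAC decay.
- exact: is_cvg_geometric_series.
Qed.

Let sumfun h x : R := limn (fun n => partial n h x).

Let sumfun_tail N h x : C x ->
  `|sumfun h x - partial N h x| <= tail_cst N h * w x.
Proof.
move=> Cx; have cv : `|partial n h x - partial N h x| @[n --> \oo] -->
    `|sumfun h x - partial N h x|.
  by apply: cvg_norm; apply: cvgB; [exact: partial_cvg|exact: cvg_cst].
have /cvg_lim <- // := cv.
apply: limr_le; first by apply/cvg_ex; eexists; exact: cv.
by exists N => // n Nn; exact: partial_tail.
Qed.

Let Lw_sumfun h : Lw C w (sumfun h).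
Proof.
apply/(LwP w_ge1); split.
  apply: (@measurable_fun_cvg _ _ _ _ (fun n => partial n h)).
    by move=> n; exact: wfun_meas.
  by move=> x Cx; exact: partial_cvg.
exists (tail_cst 0 h).
  by rewrite /tail_cst !mulr_ge0 ?wn_ge0 ?exprn_ge0// invr_ge0 ltW.
move=> x Cx; have := sumfun_tail 0 h Cx.
by rewrite [partial _ _]big_geq// subr0.
Qed.

Let neumann_bound h x b : C x -> wn h <= b ->
  `|sumfun h x| <= D / (1 - r) * b * w x.
Proof.
move=> Cx hb; have := sumfun_tail 0 h Cx.
rewrite [partial _ _]big_geq// subr0 => /le_trans; apply.
rewrite ler_wpM2r ?(ltW (w_gt0 w_ge1 Cx))// /tail_cst expr0 mulr1.
by rewrite ler_wpM2l// divr_ge0// ltW.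
Qed.

Let neumann_subproof : (fun h : X => cut (sumfun h)) \in @kop_pred _ _ _ C w.
Proof.
apply/asboolP; split.
- move=> c h1 h2; apply: wfunP => x Cx; rewrite wfunD wfunZ !cutE//.
  apply: cvg_lim => //.
  have -> : (fun n => partial n (c *: h1 + h2) x) =
      (fun n => c * partial n h1 x + partial n h2 x).
    apply/funext => n; rewrite !partialE mulr_sumr -big_split/=.
    by apply: eq_bigr => i _; rewrite kop_linear wfunD wfunZ.
  by apply: cvgD; [apply: cvgM; [exact: cvg_cst|]|]; exact: partial_cvg.
- exists (D / (1 - r)); first by rewrite divr_ge0// ltW.
  move=> h b b0 hb x Cx; rewrite cutE//; apply: neumann_bound => //.
  exact/(wn_leP w_ge1).
- move=> h_ h b b0 hb hc x Cx; rewrite cutE//.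
  under eq_fun do rewrite cutE//.
  have hb' y : C y -> `|h y| <= b * w y.
    move=> Cy; have /cvg_norm cv := hc y Cy.
    have /cvg_lim <- // := cv; apply: limr_le.
      by apply/cvg_ex; eexists; exact: cv.
    by apply: nearW => n; exact: hb.
  have wnh : wn h <= b by apply/(wn_leP w_ge1).
  have wnh_ n : wn (h_ n) <= b by apply/(wn_leP w_ge1) => //; exact: hb.
  apply/cvgrPdist_le => e e0.
  have wx := w_gt0 w_ge1 Cx.
  have [N tN] : exists N, forall k : X, wn k <= b -> tail_cst N k * w x <= e / 3.
    pose c := D / (1 - r) * b * w x.
    have c0 : 0 <= c by rewrite /c !mulr_ge0 ?invr_ge0 ?(ltW r1') ?(ltW wx).
    have /cvgr0Pnorm_le/(_ (e / 3 / (c + 1))) := cvg_expr r1.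
    have c1 : 0 < c + 1 by rewrite ltr_wpDl.
    rewrite !divr_gt0// => /(_ isT)[N _ /(_ N (leqnn N))].
    rewrite /= ger0_norm ?exprn_ge0// ler_pdivlMr// => rN; exists N => k kb.
    apply: le_trans rN; rewrite /tail_cst.
    apply: (@le_trans _ _ (r ^+ N * c)).
      have -> : D * r ^+ N / (1 - r) * wn k * w x =
        r ^+ N * (D / (1 - r) * wn k * w x) by ring.
      rewrite ler_wpM2l ?exprn_ge0// /c ler_wpM2r ?(ltW wx)//.
      by rewrite ler_wpM2l// divr_ge0// ltW.
    by rewrite ler_wpM2l ?exprn_ge0// lerDl.
  have pc : partial N (h_ n) x @[n --> \oo] --> partial N h x.
    rewrite partialE; under eq_fun do rewrite partialE.
    elim: N {tN} => [|N ih].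
      by rewrite big_geq//; under eq_fun do rewrite big_geq//; exact: cvg_cst.
    rewrite big_nat_recr//=.
    have -> : (fun n => \sum_(0 <= i < N.+1) kop_pow K i (h_ n) x) =
        (fun n => \sum_(0 <= i < N) kop_pow K i (h_ n) x + kop_pow K N (h_ n) x).
      by apply/funext => n; rewrite big_nat_recr.
    by apply: cvgD => //; exact: kop_cvg b0 hb hc _ Cx.
  have e3 : 0 < e / 3 by rewrite divr_gt0.
  near=> n.
  have h1 := le_trans (sumfun_tail N h Cx) (tN _ wnh).
  have h2 := le_trans (sumfun_tail N (h_ n) Cx) (tN _ (wnh_ n)).
  have h3 : `|partial N h x - partial N (h_ n) x| <= e / 3.
    by near: n; move/cvgrPdist_le : pc => /(_ _ e3).
  rewrite -(subrK (partial N h x) (sumfun h x)) -addrA.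
  apply: (le_trans (ler_normD _ _)).
  have -> : partial N h x - sumfun (h_ n) x =
    (partial N h x - partial N (h_ n) x) - (sumfun (h_ n) x - partial N (h_ n) x).
    by ring.
  have := ler_normB (partial N h x - partial N (h_ n) x)
    (sumfun (h_ n) x - partial N (h_ n) x).
  by lra.
Unshelve. all: by end_near. Qed.

(** The series converges uniformly in norm, so that its sum is again continuous
    along dominated convergence, and hence an operator of a kernel. *)
Lemma neumann : exists G : A,
  [/\ forall h, G h = h + K (G h), forall h, G h = h + G (K h),
    opn G <= D / (1 - r) &
    forall h x, C x ->
      \sum_(0 <= i < n) kop_pow K i h x @[n --> \oo] --> G h x].
Proof.
pose G : A := KOp neumann_subproof; exists G.
have GE h x : C x -> G h x = sumfun h x by move=> Cx; rewrite /= cutE.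
have cG h x : C x -> \sum_(0 <= i < n) kop_pow K i h x @[n --> \oo] --> G h x.
  move=> Cx; rewrite GE//; under eq_fun do rewrite -partialE.
  exact: partial_cvg.
have GK h : G h = h + G (K h).
  apply: wfunP => x Cx; rewrite wfunD.
  pose u n := \sum_(0 <= i < n) kop_pow K i h x.
  have uE : (fun n => u n.+1) =
      (fun n => h x + \sum_(0 <= i < n) kop_pow K i (K h) x).
    apply/funext => n; rewrite /u big_nat_recl//=; congr (_ + _).
    by apply: eq_bigr => i _; rewrite -kop_powSr.
  have cu : u n.+1 @[n --> \oo] --> h x + G (K h) x.
    by rewrite uE; apply: cvgD; [exact: cvg_cst|exact: cG].
  rewrite (cvg_shiftS u) in cu.
  exact: (cvg_unique _ (cG h x Cx) cu).
split => //; last first.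
  apply/(opn_leP mC mw w_ge1); first by rewrite divr_ge0// ltW.
  move=> h; apply/(wn_leP w_ge1).
    by rewrite mulr_ge0 ?wn_ge0// divr_ge0// ltW.
  by move=> x Cx; rewrite GE//; exact: neumann_bound.
(* K commutes with every partial sum, hence with the limit. *)
move=> h; rewrite {1}GK; congr (_ + _); apply: wfunP => x Cx.
apply: (cvg_unique _ (cG (K h) x Cx)) => //.
have cK : K (partial n h) x @[n --> \oo] --> K (G h) x.
  apply: (@kop_cvg _ _ _ C w K (fun n => partial n h) (G h)
    (D / (1 - r) * wn h + tail_cst 0 h)).
  - by rewrite addr_ge0// /tail_cst !mulr_ge0 ?wn_ge0 ?exprn_ge0// invr_ge0 ltW.
  - move=> n y Cy.
    have := partial_tail h Cy (leq0n n); rewrite [partial 0 _]big_geq// subr0.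
    move=> /le_trans; apply; rewrite ler_wpM2r ?(ltW (w_gt0 w_ge1 Cy))//.
    by rewrite lerDr mulr_ge0 ?wn_ge0// divr_ge0// ltW.
  - by move=> y Cy; rewrite GE//; exact: partial_cvg.
  - exact: Cx.
apply: cvg_trans cK; apply: near_eq_cvg; near=> n.
rewrite /partial kop_sum wfun_sum; apply: eq_bigr => i _.
by rewrite -kop_powSr.
Unshelve. all: by end_near. Qed.

End Series.
End Neumann.
(** * Resolvents of kernels *)

Section Resolvent.
Context {d : measure_display} {S : measurableType d} {R : realType}.
Variables (C : set S) (w : S -> R).
Hypotheses (mC : measurable C) (mw : measurable_fun C w).
Hypothesis w_ge1 : forall x, C x -> 1 <= w x.
Local Notation X := (wfun C w).
Local Notation A := (kop C w).
Local Notation ind := (ind w_ge1).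
Local Notation cut := (cut w_ge1).
Local Notation opn := (opn w_ge1).
Local Notation op := (op_of_kernel mC mw w_ge1).
Local Notation kernel := (kernel_of_op w_ge1).
Implicit Types (Q : S -> set S -> R) (T G : A) (B : R).

Let snA := seminorm_opn mC mw w_ge1.
Let snX : seminorm (@wn _ _ _ C w) := seminorm_wn w_ge1.
Let lA := isolift_LLw mC mw w_ge1.
Let lX := isolift_Lw w_ge1.

Definition is_resolvent T G B : Prop :=
  [/\ forall h, G h = h + T (G h), forall h, G h = h + G (T h), opn G <= B &
    forall h x, C x -> \sum_(0 <= i < n) kop_pow T i h x @[n --> \oo] --> G h x].

Lemma op_of_skpow Q n : LLw C w Q ->
  LLw C w (skpow C Q n) /\ op (skpow C Q n) = kop_pow (op Q) n.
Proof.
move=> LQ; elim: n => [|n [Ln opE]]; first exact: op_of_skid.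
have [L1 oE] := op_of_skcomp mC mw w_ge1 LQ Ln; split => //.
by rewrite -[RHS]/(kop_comp (op Q) (kop_pow (op Q) n)) -opE.
Qed.

(** Norm continuity of s |-> K(s)^m keeps the contraction property near t0 with
    one constant q, so that one bound B serves for all resolvents. *)
Lemma resolvent_family (K : R -> S -> set S -> R) t0 m :
  (\forall s \near t0, LLw C w (K s)) -> cts_at opn (op \o K) t0 ->
  (0 < m)%N -> (sknorm C w (skpow C (K t0) m) < 1)%E ->
  exists B (G : R -> A), \forall s \near t0, is_resolvent (op (K s)) (G s) B.
Proof.
move=> LK cK m0 Km.
pose k s := op (K s).
have [Lm opm] := op_of_skpow m (nbhs_singleton LK).
pose a := opn (kop_pow (k t0) m).
have a1 : a < 1 by rewrite -lte_fin /a /k -opm -(lift_norm lA).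
have a0 : 0 <= a by exact: opn_ge0.
pose q := (1 + a) / 2.
have k0 : 0 <= opn (k t0) + 1 by rewrite addr_ge0 ?opn_ge0.
have q01 : 0 <= q < 1 by rewrite /q; apply/andP; split; lra.
have [D [r [D0 r01 dec]]] := geometric_decay m0 q01 k0.
suff /choice[G HG] : forall s, exists G : A,
    LLw C w (K s) -> opn (k s) <= opn (k t0) + 1 -> opn (kop_pow (k s) m) <= q ->
    is_resolvent (k s) G (D / (1 - r)).
  have c1 : \forall s \near t0, opn (k s - k t0) <= 1 by exact: cK.
  have cm : \forall s \near t0,
      opn (kop_pow (k s) m - kop_pow (k t0) m) <= (1 - a) / 2.
    by apply: (cts_kop_pow mC mw m cK); lra.
  exists (D / (1 - r)), G; near=> s; apply: HG; first by near: s.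
    apply: (le_trans (seminorm_leB snA (k s) (k t0))); rewrite lerD2l.
    by near: s.
  apply: (le_trans (seminorm_leB snA _ (kop_pow (k t0) m))).
  have -> : q = a + (1 - a) / 2 by rewrite /q; field.
  by rewrite lerD2l; near: s.
move=> s.
have [[bk bm]|nb] := pselect (opn (k s) <= opn (k t0) + 1 /\
  opn (kop_pow (k s) m) <= q); last first.
  by exists 0 => _ h1 h2; case: nb.
have ds n h : wn (kop_pow (k s) n h) <= D * r ^+ n * wn h.
  apply: (le_trans (opn_bound mC mw w_ge1 _ _)); apply: ler_wpM2r (wn_ge0 _) _ _ _.
  apply: (dec (fun n => opn (kop_pow (k s) n))).
  - by move=> j; exact: opn_ge0.
  - by apply/(opn_leP mC mw w_ge1) => // h'; rewrite mul1r.
  - move=> j; apply: (le_trans (opn_comp mC mw w_ge1 _ _)).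
    by apply: ler_wpM2r bk; exact: opn_ge0.
  - move=> j; have -> : kop_pow (k s) (j + m) =
        kop_comp (kop_pow (k s) j) (kop_pow (k s) m).
      by apply: kopP => h' x Cx; rewrite kop_powD.
    apply: (le_trans (opn_comp mC mw w_ge1 _ _)); rewrite mulrC.
    by apply: ler_wpM2r bm; exact: opn_ge0.
have [G [g1 g2 g3 g4]] := neumann mC mw w_ge1 D0 r01 ds.
by exists G.
Unshelve. all: by end_near. Qed.

Lemma cut_skact Q (h : S -> R) : LLw C w Q -> Lw C w h ->
  Lw C w (skact C Q h) /\ cut (skact C Q h) = op Q (cut h).
Proof.
move=> LQ Lh.
have L : Lw C w (skact C Q h).
  apply: (@eq_Lw _ _ _ _ _ w_ge1 (op Q (cut h))); last exact: Lw_wfun.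
  by move=> x Cx; rewrite -(skactE mC mw w_ge1).
by split => //; apply: wfunP => x Cx; rewrite cutE// (skactE mC mw w_ge1).
Qed.

Section AtPoint.
Variables (Q : S -> set S -> R) (G : A) (B : R).
Hypotheses (LQ : LLw C w Q) (rG : is_resolvent (op Q) G B).

Let subE : LLw C w (skid - Q) /\ op (skid - Q) = kop_id C w - op Q.
Proof.
have [L1 oE] := op_of_skid mC mw w_ge1.
by have := liftB lA L1 LQ; rewrite oE.
Qed.

Lemma invertible_of_resolvent : invertible_on_Lw C w (skact C (skid - Q)).
Proof.
have [LI oI] := subE; have [g1 g2 g3 _] := rG.
split; first by move=> u Lu; have [] := cut_skact LI Lu.
exists B => h Lh; exists (G (cut h)); split.
- exact: Lw_wfun.
- move=> x /set_mem Cx; rewrite (skactE mC mw w_ge1)//; last exact: Lw_wfun.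
  by rewrite oI cutK kopDE kopNE -[kop_id _ _ _]/(G (cut h)) {1}g1 addrK cutE.
- move=> v Lv Av x xC; have Cx := set_mem xC.
  rewrite -(cutE w_ge1 Lv Cx); congr (wfun_fun _ x).
  have -> : cut h = cut v - op Q (cut v).
    apply: wfunP => y Cy; rewrite cutE// -Av ?mem_set// (skactE mC mw w_ge1)//.
    by rewrite oI.
  by rewrite kopB {1}g2 addrK.
- have -> : wnorm C w (G (cut h)) = (wn (G (cut h)))%:E.
    exact: LwE (Lw_wfun w_ge1 _).
  rewrite (lift_norm lX Lh) -EFinM lee_fin.
  by apply: (le_trans (opn_bound mC mw w_ge1 _ _)); apply: ler_wpM2r g3; exact: wn_ge0.
Qed.

Lemma inverse_of_resolvent : inverse_on_Lw C w (skid - Q) (kernel G).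
Proof.
have [LI oI] := subE; have [g1 g2 _ _] := rG.
have [LG oG] := lift_section lA G.
move=> h Lh; have [L1 c1] := cut_skact LI Lh; have [L2 c2] := cut_skact LG Lh.
split=> x /set_mem Cx.
- rewrite (skactE mC mw w_ge1)// oG c1 oI kopDE kopNE -[kop_id _ _ _]/(cut h).
  by rewrite kopB {1}g2 addrK cutE.
- rewrite (skactE mC mw w_ge1)// c2 oG oI kopDE kopNE -[kop_id _ _ _]/(G (cut h)).
  by rewrite {1}g1 addrK cutE.
Qed.

Lemma neumann_eseries (f : S -> R) x : Lw C w f -> C x ->
  (\sum_(0 <= n <oo) eskact C (skpow C Q n) f x)%E = (G (cut f) x)%:E.
Proof.
move=> Lf Cx; have [_ _ _ cG] := rG.
apply: cvg_lim => //.
have -> : (fun n => (\sum_(0 <= i < n) eskact C (skpow C Q i) f x)%E) =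
    EFin \o (fun n => \sum_(0 <= i < n) kop_pow (op Q) i (cut f) x).
  apply/funext => n /=; rewrite -sumEFin; apply: eq_bigr => i _.
  by have [Li <-] := op_of_skpow i LQ; rewrite (eskactE mC mw w_ge1).
by apply: cvg_EFin; [exact: nearW|exact: cG].
Qed.

(** With this order of the factors the resolvent solves G = 1 + comp_act K G,
    an equation of the same form as the one of u*. *)
Definition comp_act T1 T2 : A := kop_comp T2 T1.

Lemma resolvent_apriori z : wn z <= B * wn (z - op Q z).
Proof.
have [g1 g2 g3 _] := rG.
have {1}-> : z = G (z - op Q z) by rewrite kopB {1}g2 addrK.
by apply: (le_trans (opn_bound mC mw w_ge1 _ _)); apply: ler_wpM2r g3; exact: wn_ge0.
Qed.

Lemma resolvent_apriori_comp T : opn T <= B * opn (T - comp_act (op Q) T).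
Proof.
have [g1 g2 g3 _] := rG.
have {1}-> : T = kop_comp (T - comp_act (op Q) T) G.
  apply: kopP => h x Cx; rewrite -[kop_comp _ _ _]/(T (G h) - T (op Q (G h))).
  by rewrite -kopB {1}g1 addrK.
apply: (le_trans (opn_comp mC mw w_ge1 _ _)); rewrite mulrC.
by apply: ler_wpM2r g3; exact: opn_ge0.
Qed.

Lemma resolvent_comp T : kop_comp T G = T + comp_act (op Q) (kop_comp T G).
Proof.
have [_ g2 _ _] := rG; apply: kopP => h x Cx.
by rewrite -[LHS]/(T (G h) x) g2 kopD.
Qed.

End AtPoint.
End Resolvent.
(** * Differentiability of the resolvent and of u* *)

Theorem theorem2p1 (R : realType) (d : measure_display) (S : measurableType d)
  (C : set S) (mC : measurable C)
  (f g : S -> R) (mf : measurable_fun [set: S] f) (f_ge0 : forall x, 0 <= f x)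
  (mg : measurable_fun [set: S] g)
  (a b : R) (P : R -> R.-pker S ~> S)
  (w : S -> R) (mw : measurable_fun C w) (w_ge1 : forall x, C x -> 1 <= w x)
  (K_LLw : forall t, a < t < b -> LLw C w (Kfam g P t))
  (ftilde_fin : forall t x, a < t < b -> C x -> eftilde C f g P t x \is a fin_num)
  (ftilde_Lw : forall t, a < t < b -> Lw C w (ftilde C f g P t))
  (t0 : R) (t0ab : a < t0 < b)
  (m : nat) (m_ge1 : (1 <= m)%N)
  (Km_lt1 : (sknorm C w (skpow C (Kfam g P t0) m) < 1)%E)
  (cont : bool)
  (K' : S -> set S -> R)
  (K_diff : has_cderiv (LLw C w) (sknorm C w) cont (Kfam g P) t0 K')
  (f' : S -> R)
  (ftilde_diff : has_cderiv (Lw C w) (wnorm C w) cont (ftilde C f g P) t0 f') :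
  (\forall t \near t0, invertible_on_Lw C w (skact C (skid - Kfam g P t))) /\
  exists G : R -> S -> set S -> R,
    let G' := skcomp C (G t0) (skcomp C K' (G t0)) in
    [/\ \forall t \near t0,
          LLw C w (G t) /\ inverse_on_Lw C w (skid - Kfam g P t) (G t),
        has_cderiv (LLw C w) (sknorm C w) cont G t0 G',
        \forall t \near t0, forall x, C x -> eustar C f g P t x \is a fin_num,
        has_cderiv (Lw C w) (wnorm C w) cont (ustar C f g P) t0
          (skact C G' (ftilde C f g P t0) + skact C (G t0) f') &
        forall (n : nat) (DK : nat -> R -> S -> set S -> R)
            (Df : nat -> R -> S -> R),
          (1 <= n)%N ->
          has_ncderiv (LLw C w) (sknorm C w) cont n (Kfam g P) t0 DK ->
          has_ncderiv (Lw C w) (wnorm C w) cont n (ftilde C f g P) t0 Df ->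
          exists (DG : nat -> R -> S -> set S -> R) (Du : nat -> R -> S -> R),
            [/\ has_ncderiv (LLw C w) (sknorm C w) cont n G t0 DG,
                has_ncderiv (Lw C w) (wnorm C w) cont n (ustar C f g P) t0 Du,
                forall x A, C x -> measurable A -> A `<=` C ->
                  DG n t0 x A =
                  \sum_(j < n) 'C(n, j)%:R *
                    skcomp C (DG j t0) (skcomp C (DK (n - j)%N t0) (G t0)) x A &
                forall x, C x ->
                  Du n t0 x =
                  skact C (G t0)
                    (Df n t0 + \sum_(j < n)
                       'C(n, j)%:R *: skact C (DK (n - j)%N t0) (Du j t0)) x]].
Proof.
set K := Kfam g P in K_diff Km_lt1 *.
set F := ftilde C f g P in ftilde_diff *.
pose op := op_of_kernel mC mw w_ge1.
pose cut := cut w_ge1.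
have snA := seminorm_opn mC mw w_ge1.
have snX : seminorm (@wn _ _ _ C w) := seminorm_wn w_ge1.
have lA := isolift_LLw mC mw w_ge1.
have lX := isolift_Lw w_ge1.
have [LK LK' dK] := (has_cderivP snA lA _ _ _ _).1 K_diff.
have [LF Lf' dF] := (has_cderivP snX lX _ _ _ _).1 ftilde_diff.
have [B [Gam rG]] := resolvent_family LK (cdiff_cts snA dK) m_ge1 Km_lt1.
have [g1 g2 _ _] := nbhs_singleton rG.
have LKt0 := nbhs_singleton LK.
have LFt0 := nbhs_singleton LF.
have [Lid opid] := op_of_skid mC mw w_ge1.
have [L0 op0] := liftB lA Lid Lid; rewrite !subrr -/op in L0 op0.
pose G t := kernel_of_op w_ge1 (Gam t).
have LG t : LLw C w (G t) := (lift_section lA (Gam t)).1.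
have opG t : op (G t) = Gam t := (lift_section lA (Gam t)).2.
split.
  near=> t; apply: (@invertible_of_resolvent _ _ _ C w mC mw w_ge1 _ (Gam t) B).
    by near: t.
  by near: t.
exists G => G'.
have [LKG opKG] := op_of_skcomp mC mw w_ge1 LK' (LG t0).
have [LG' opG'] := op_of_skcomp mC mw w_ge1 (LG t0) LKG.
rewrite opKG -/op !opG in opG'.
have euE : \forall t \near t0, forall x, C x ->
    eustar C f g P t x = (Gam t (cut (F t)) x)%:E.
  near=> t => x Cx.
  have rs : is_resolvent w_ge1 (op (K t)) (Gam t) B by near: t.
  have LKt : LLw C w (K t) by near: t.
  have LFt : Lw C w (F t) by near: t.
  exact: (neumann_eseries LKt rs LFt Cx).
(* K(theta) acts on functions by application and on kernels by composition on
   the right; u* and G solve the two corresponding fixed point equations, with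
   right hand sides f~ and the identity. *)
pose app (T : kop C w) (h : wfun C w) : wfun C w := T h.
have appBl p q y : app (p - q) y = app p y - app q y by [].
have appZl c q y : app (c *: q) y = c *: app q y by [].
have appBr q y z : app q (y - z) = app q y - app q z by exact: kopB.
have appZr c q y : app q (c *: y) = c *: app q y by exact: kopZ.
have app_le q y : wn (app q y) <= opn w_ge1 q * wn y by exact: opn_bound.
have cmpBl p q y : @comp_act _ _ _ C w (p - q) y = comp_act p y - comp_act q y.
  exact: kop_compBr.
have cmpZl c q y : @comp_act _ _ _ C w (c *: q) y = c *: comp_act q y.
  exact: kop_compZr.
have cmpBr q y z : @comp_act _ _ _ C w q (y - z) = comp_act q y - comp_act q z.
  exact: kop_compBl.
have cmpZr c q y : @comp_act _ _ _ C w q (c *: y) = c *: comp_act q y.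
  exact: kop_compZl.
have cmp_le q y : opn w_ge1 (comp_act q y) <= opn w_ge1 q * opn w_ge1 y.
  by rewrite mulrC; exact: opn_comp.
have rsX : \forall s \near t0, resolved (@wn _ _ _ C w) app (op \o K) B
    (fun s h => Gam s h) s.
  near=> s; have rs : is_resolvent w_ge1 (op (K s)) (Gam s) B by near: s.
  split=> z; first exact: resolvent_apriori rs _.
  by case: rs => h _ _ _; exact: h.
have rsA : \forall s \near t0, resolved (opn w_ge1) (@comp_act _ _ _ C w)
    (op \o K) B (fun s T => kop_comp T (Gam s)) s.
  near=> s; have rs : is_resolvent w_ge1 (op (K s)) (Gam s) B by near: s.
  split=> z; first exact: resolvent_apriori_comp rs _.
  exact: resolvent_comp rs _.
have solA : \forall s \near t0, LLw C w (G s) /\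
    solves (@comp_act _ _ _ C w) (op \o K) (op \o G) (op \o (fun=> skid)) s.
  near=> s; have rs : is_resolvent w_ge1 (op (K s)) (Gam s) B by near: s.
  split; first exact: LG.
  apply: (etrans (opG s)); rewrite -[(op \o G) s]/(op (G s)) opG.
  rewrite -[(op \o (fun=> skid)) s]/(op skid) [op skid]opid.
  apply: kopP => h x Cx; case: rs => _ h2 _ _.
  exact: (congr1 (fun k : wfun C w => k x) (h2 h)).
have solX : \forall s \near t0, Lw C w (ustar C f g P s) /\
    solves app (op \o K) (cut \o ustar C f g P) (cut \o F) s.
  near=> s; have rs : is_resolvent w_ge1 (op (K s)) (Gam s) B by near: s.
  have uE : forall x, C x -> Gam s (cut (F s)) x = ustar C f g P s x.
    have eE : forall x, C x -> eustar C f g P s x = (Gam s (cut (F s)) x)%:E.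
      by near: s.
    by move=> x Cx; rewrite /ustar eE.
  have LuG := Lw_wfun w_ge1 (Gam s (cut (F s))).
  have Lu := eq_Lw w_ge1 uE LuG; split => //.
  have cu : cut (ustar C f g P s) = Gam s (cut (F s)).
    by rewrite /cut -(eq_cut _ LuG uE) cutK.
  rewrite /solves -[(cut \o _) s]/(cut (ustar C f g P s)) cu.
  by case: rs => h _ _ _; exact: h.
have u0 : cut (ustar C f g P t0) = Gam t0 (cut (F t0)).
  apply: wfunP => x Cx; rewrite cutE//; last by have [] := nbhs_singleton solX.
  by rewrite /ustar (nbhs_singleton euE).
split.
- near=> t; split; first exact: LG.
  apply: (@inverse_of_resolvent _ _ _ C w mC mw w_ge1 _ (Gam t) B).
    by near: t.
  by near: t.
- have [_ cid] := has_ncderiv_cst snA lA cont 0 t0 Lid.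
  apply: (has_cderiv_solution snA snA lA lA cmpBl cmpZl cmpBr cmpZr cmp_le
    rsA solA K_diff cid); first exact: LG'.
  rewrite -/op opG' op0 add0r opG; apply: kopP => h x Cx.
  by rewrite -[LHS]/(Gam t0 (op K' (Gam t0 h)) x) (g2 h) !kopD.
- near=> t => x Cx; have -> : eustar C f g P t x = (Gam t (cut (F t)) x)%:E.
    by move: x Cx; near: t.
  by [].
- pose v := skact C G' (F t0) + skact C (G t0) f'.
  have vE x : C x -> (Gam t0 (op K' (Gam t0 (cut (F t0)))) + Gam t0 (cut f')) x
      = v x.
    move=> Cx; rewrite wfunD /v -[RHS]/(skact C G' (F t0) x + skact C (G t0) f' x).
    rewrite (skactE mC mw w_ge1 LG' LFt0 Cx) -/op opG'.
    by rewrite (skactE mC mw w_ge1 (LG t0) Lf' Cx) -/op opG.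
  have Lv0 := Lw_wfun w_ge1 (Gam t0 (op K' (Gam t0 (cut (F t0)))) + Gam t0 (cut f')).
  have Lv : Lw C w v := eq_Lw w_ge1 vE Lv0.
  apply: (has_cderiv_solution snA snX lA lX appBl appZl appBr appZr app_le
    rsX solX K_diff ftilde_diff); first exact: Lv.
  have cv := eq_cut w_ge1 Lv0 vE; rewrite cutK -/cut in cv.
  rewrite -/cut -/op -cv u0 [cut f' + _]addrC.
  have := g1 (op K' (Gam t0 (cut (F t0))) + cut f').
  by rewrite kopD.
- move=> [//|n] DK Df _ hK hF.
  have [DG hDG [LDG DGE]] := has_ncderiv_solution snA snA lA lA cmpBl cmpZl
    cmpBr cmpZr cmp_le rsA solA hK (has_ncderiv_cst snA lA cont n t0 Lid).
  have [Du hDu [LDu DuE]] := has_ncderiv_solution snA snX lA lX appBl appZl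
    appBr appZr app_le rsX solX hK hF.
  have [_ MK MKn _ _] := has_ncderiv_cdiff snA lA hK.
  have [_ _ MFn _ _] := has_ncderiv_cdiff snX lX hF.
  have LDK i : (i <= n.+1)%N -> LLw C w (DK i t0).
    rewrite leq_eqVlt => /predU1P[->//|]; rewrite ltnS => /MK.
    exact: nbhs_singleton.
  exists DG, Du; split; [exact: hDG|exact: hDu|move=> x A Cx mA AC|move=> x Cx].
    rewrite DGE /leibniz_rhs /= -/op op0 add0r /kernel_of_op.
    have -> T : kop_comp T (Gam t0) (ind w_ge1 A) = T (Gam t0 (ind w_ge1 A)) by [].
    have sumE N (T : 'I_N -> kop C w) h : (\sum_i T i) h = \sum_i T i h.
      by elim/big_rec2 : _ => // i y1 y2 _ <-.
    rewrite sumE wfun_sum; apply: eq_bigr => j _.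
    rewrite kopZE wfunZ; congr (_ * _).
    have jn : (j <= n)%N by rewrite -ltnS.
    have [L1 o1] := op_of_skcomp mC mw w_ge1 (LDK _ (leq_subr j n.+1)) (LG t0).
    have [L2 o2] := op_of_skcomp mC mw w_ge1 (LDG _ jn) L1.
    rewrite (op_of_kernelK mC mw w_ge1 L2 Cx mA AC) o2 o1 -/op opG.
    by [].
  have LkD (j : 'I_n.+1) : Lw C w (skact C (DK (n.+1 - j)%N t0) (Du j t0)) /\
      cut (skact C (DK (n.+1 - j)%N t0) (Du j t0)) =
      op (DK (n.+1 - j)%N t0) (cut (Du j t0)).
    apply: (cut_skact mC mw w_ge1); first exact: LDK (leq_subr _ _).
    by apply: LDu; rewrite -ltnS.
  have LkZ (j : 'I_n.+1) := liftZ lX 'C(n.+1, j)%:R (LkD j).1.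
  have [Ls cs] := lift_sum lX (fun j => (LkZ j).1).
  have [Lr cr] := liftD lX MFn Ls.
  rewrite DuE (skactE mC mw w_ge1 (LG t0) Lr Cx) -/op opG.
  congr (wfun_fun (Gam t0 _) x); rewrite cr cs /leibniz_rhs; congr (_ + _).
  by apply: eq_bigr => j _; rewrite (LkZ j).2 -/cut (LkD j).2.
Unshelve. all: by end_near. Qed.
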